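(* For every $\alpha>1$ there are finite constants $B_\alpha$ and $C_\alpha$, depending only on $\alpha$, such that the following holds. Let $0<p<\infty$, $K\ge1$, and $M<\infty$. If $f\in\mathcal G^p_{K,\alpha}(M)$, then every convex curve $\Gamma\subset\mathbb D$ satisfies $$\int_\Gamma |f(z)|^p\,ds(z)\le B_\alpha M^p\int_{\mathbb T}|f^*(\xi)|^p\,|d\xi|.$$ More generally, if $\mu$ is a Carleson measure on $\mathbb D$, then $$\int_{\mathbb D}|f(z)|^p\,d\mu(z)\le C_\alpha\|\mu\|_{\mathrm{Car}}\,M^p\int_{\mathbb T}|f^*(\xi)|^p\,|d\xi|.$$
   Context: $\mathbb D=\{z\in\mathbb C:|z|<1\}$, $\mathbb T=\partial\mathbb D$, $|d\xi|$ is arclength measure on $\mathbb T$, and $ds$ is arclength. A mapping $f:\mathbb D\to\mathbb C$ is $K$-quasiregular ($K\ge1$) if $f\in W^{1,2}_{\mathrm{loc}}(\mathbb D)$, its Jacobian satisfies $J_f\ge0$ a.e., and $|Df(z)|^2\le K J_f(z)$ for a.e. $z\in\mathbb D$ (equivalently $|f_{\bar z}|\le k|f_z|$ a.e. with $K=(1+k)/(1-k)$). For $\alpha>1$ and $\xi\in\mathbb T$ the Stolz cone is $\Gamma_\alpha(\xi)=\{z\in\mathbb D:|z-\xi|<\alpha(1-|z|)\}$, and for a function $u$ on $\mathbb D$, $N_\alpha u(\xi)=\sup_{z\in\Gamma_\alpha(\xi)}|u(z)|$. For $0<p<\infty$, $K\ge1$, $\alpha>1$, $M<\infty$, a $K$-quasiregular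 mapping $f:\mathbb D\to\mathbb C$ belongs to $\mathcal G^p_{K,\alpha}(M)$ if: (i) $f$ has a non-tangential boundary limit $f^*(\xi)=\lim_{z\to\xi,\,z\in\Gamma_\alpha(\xi)}f(z)$ for a.e. $\xi\in\mathbb T$; (ii) $f^*\in L^p(\mathbb T)$; (iii) $\|N_\alpha f\|_{L^p(\mathbb T)}\le M\|f^*\|_{L^p(\mathbb T)}$. For an arc $I\subset\mathbb T$ with arclength $|I|$, the Carleson box is $S(I)=\{re^{it}:e^{it}\in I,\ 1-\frac{|I|}{2\pi}\le r<1\}$. A finite positive Borel measure $\mu$ on $\mathbb D$ is a Carleson measure if $\|\mu\|_{\mathrm{Car}}:=\sup_{I\subset\mathbb T}\mu(S(I))/|I|<\infty$, the supremum being over arcs $I$. A convex curve means a simple rectifiable arc, or a closed rectifiable curve, contained in the boundary of a convex subset of $\mathbb D$; line segments are allowed. Repeated parametrizations are excluded: the relevant measure is arclength on the trace. *)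

(* Defs.v *)
From HB Require Import structures.
From mathcomp Require Import all_boot all_order all_algebra.
From mathcomp Require Import all_classical all_reals all_analysis.
From mathcomp Require Import measurable_realfun.
Import Order.TTheory GRing.Theory Num.Theory.
Import numFieldNormedType.Exports.

Set Implicit Arguments.
Unset Strict Implicit.
Unset Printing Implicit Defensive.

Local Open Scope classical_set_scope.
Local Open Scope ring_scope.

(* The complex plane is the real plane [R * R] with the product topology and
   the product (that is, Borel) sigma-algebra.  The library norm on a product
   is the maximum norm, hence the separate definition of the modulus. *)
Notation plane R := (R * R)%type.

Section Plane.
Context {R : realType}.
Implicit Types z : plane R.

Definition modulus z : R := Num.sqrt (z.1 ^+ 2 + z.2 ^+ 2).

Definition disk : set (plane R) := [set z | modulus z < 1].

Definition cis (t : R) : plane R := (cos t, sin t).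

Lemma measurable_cis : measurable_fun [set: R] cis.
Proof.
apply: measurable_fun_pair; apply: continuous_measurable_fun.
- exact: continuous_cos.
- exact: continuous_sin.
Qed.

(* Arclength on the unit circle, as a Borel measure on the plane that is
   carried by the circle. *)
Definition circle_measure : set (plane R) -> \bar R :=
  pushforward (mrestr (@lebesgue_measure R) (measurable_itv `[0, 2 * pi[)) cis.

Let circle_measure0 : circle_measure set0 = 0%E.
Proof. by rewrite /circle_measure /pushforward preimage_set0 measure0. Qed.

Let circle_measure_ge0 A : (0 <= circle_measure A)%E.
Proof. by rewrite /circle_measure /pushforward. Qed.

Let circle_measure_sigma_additive : semi_sigma_additive circle_measure.
Proof.
move=> F mF tF mUF; rewrite /circle_measure /pushforward preimage_bigcup.
apply: measure_semi_sigma_additive.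
- by move=> n; rewrite -[X in measurable X]setTI; exact: measurable_cis.
- apply/trivIsetP => /= i j _ _ ij; rewrite -preimage_setI.
  by move/trivIsetP : tF => /(_ _ _ _ _ ij) ->//; rewrite preimage_set0.
- by rewrite -preimage_bigcup -[X in measurable X]setTI; exact: measurable_cis.
Qed.

HB.instance Definition _ := isMeasure.Build _ _ _ circle_measure
  circle_measure0 circle_measure_ge0 circle_measure_sigma_additive.

Definition area := (@lebesgue_measure R \x @lebesgue_measure R)%E.

HB.instance Definition _ := Measure.on area.

End Plane.

Section Quasiregular.
Context {R : realType}.
Implicit Types (u g phi : plane R -> R) (v z : plane R).

Definition smooth phi := forall (s : seq (plane R)) z,
  differentiable (foldr (fun v psi z => 'D_v psi z) phi s) z.

Definition test_function phi :=
  smooth phi /\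
  exists A, [/\ compact A, A `<=` disk & forall z, ~ A z -> phi z = 0].

(* The functions here are defined pointwise, as maximal functions and line
   integrals require, and Borel on the disk; they are not classes modulo
   equality almost everywhere. *)
Definition L2_loc u :=
  measurable_fun disk u /\
  forall A, compact A -> A `<=` disk ->
    (\int[area]_(z in A) ((u z) ^+ 2)%:E < +oo)%E.

(* [g] is the weak derivative of [u] in the direction [v] *)
Definition weak_derivative u v g := forall phi, test_function phi ->
  (\int[area]_(z in disk) (u z * 'D_v phi z)%:E =
   - \int[area]_(z in disk) (g z * phi z)%:E)%E.

Definition W12_loc_with u ux uy :=
  [/\ L2_loc u, L2_loc ux, L2_loc uy,
      weak_derivative u (1, 0) ux & weak_derivative u (0, 1) uy].

(* operator norm of the real 2 x 2 matrix with rows [(a, b)] and [(c, d)] *)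
Definition opnorm (a b c d : R) : R :=
  sup [set modulus (a * h.1 + b * h.2, c * h.1 + d * h.2)
      | h in [set h : plane R | modulus h <= 1]].

Definition quasiregular (K : R) (f : plane R -> plane R) :=
  exists ux uy vx vy : plane R -> R,
  [/\ W12_loc_with (fun z => (f z).1) ux uy,
      W12_loc_with (fun z => (f z).2) vx vy,
      {ae area, forall z, disk z -> 0 <= ux z * vy z - uy z * vx z}
    & {ae area, forall z, disk z ->
        opnorm (ux z) (uy z) (vx z) (vy z) ^+ 2 <=
        K * (ux z * vy z - uy z * vx z)}].

End Quasiregular.

Section BoundaryBehaviour.
Context {R : realType}.
Implicit Types (xi z : plane R) (f : plane R -> plane R).

Definition stolz (alpha : R) xi : set (plane R) :=
  [set z | disk z /\ modulus (z - xi) < alpha * (1 - modulus z)].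

Definition nt_max (alpha : R) f xi : \bar R :=
  ereal_sup [set (modulus (f z))%:E | z in stolz alpha xi].

(* the filter of [z --> xi] with [z] in the Stolz cone at [xi] *)
Definition nt_nbhs (alpha : R) xi := within (stolz alpha xi) (nbhs xi).

(* The limit operator is total, so [bdry alpha f xi] is an arbitrary point
   when the non-tangential limit does not exist. *)
Definition bdry (alpha : R) f xi : plane R :=
  [lim f z @[z --> nt_nbhs alpha xi] in (plane R : normedModType R)].

(* the L^p norm on the circle, for functions with values in [0, +oo] *)
Definition Lp_norm_circle (p : R) (h : plane R -> \bar R) : \bar R :=
  Lnorm circle_measure p%:E h.

Definition in_class_G (p K alpha M : R) f :=
  [/\ quasiregular K f,
      {ae circle_measure, forall xi,
        [cvg f z @[z --> nt_nbhs alpha xi] in (plane R : normedModType R)]},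
      (exists2 h : plane R -> plane R, measurable_fun setT h &
        {ae circle_measure, forall xi, bdry alpha f xi = h xi}) /\
      (Lp_norm_circle p (fun xi => (modulus (bdry alpha f xi))%:E) < +oo)%E
    & (Lp_norm_circle p (nt_max alpha f) <=
       M%:E * Lp_norm_circle p (fun xi => (modulus (bdry alpha f xi))%:E))%E].

End BoundaryBehaviour.

Section Carleson.
Context {R : realType}.

(* The arcs of the circle are the images under [cis] of the intervals with
   end points [s < t <= s + 2 * pi], each end point included or not; such an
   arc has length [t - s]. *)
Definition circle_arc (b1 b2 : bool) (s t : R) : set (plane R) :=
  cis @` [set` Interval (BSide b1 s) (BSide b2 t)].

(* the Carleson box over the arc [I] of length [l] *)
Definition carleson_box (I : set (plane R)) (l : R) : set (plane R) :=
  [set r *: xi | r in `[1 - l / (2 * pi), 1[ & xi in I].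

Definition carleson_norm (mu : set (plane R) -> \bar R) : \bar R :=
  ereal_sup [set e | exists b1 b2 s t, [/\ s < t, t <= s + 2 * pi &
    e = (mu (carleson_box (circle_arc b1 b2 s t) (t - s)) * ((t - s)^-1)%:E)%E]].

(* A Borel measure on the disk is a Borel measure on the plane that vanishes
   outside the disk. *)
Definition carleson_measure (mu : {finite_measure set (plane R) -> \bar R}) :=
  mu (~` disk) = 0%E /\ (carleson_norm mu < +oo)%E.

End Carleson.

Section Curves.
Context {R : realType}.
Implicit Types (gamma : R -> plane R) (Gamma : set (plane R)).

Definition polygonal_length gamma (a b : R) (s : seq R) : R :=
  let F := gamma \o nth b (a :: s) in
  \sum_(0 <= n < size s) modulus (F n.+1 - F n).

Definition curve_length gamma (a b : R) : \bar R :=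
  ereal_sup [set (polygonal_length gamma a b s)%:E | s in itv_partition a b].

(* [Gamma] is the trace of the rectifiable curve [gamma] on [a, b], which is a
   simple arc or a closed curve. *)
Definition rectifiable_arc_or_closed Gamma := exists a b gamma,
  [/\ a <= b, {within `[a, b], continuous gamma},
      (curve_length gamma a b < +oo)%E,
      {in `[a, b] &, injective gamma} \/ gamma a = gamma b
    & Gamma = gamma @` `[a, b]].

Definition convex_curve Gamma :=
  rectifiable_arc_or_closed Gamma /\
  exists C : set (plane R),
    [/\ convex_set C, C `<=` disk & Gamma `<=` closure C `\` C°].

(* Arclength parametrization of the trace [Gamma], run through once: arclength
   on [Gamma] is the image of Lebesgue measure on [0, L] by [gamma]. *)
Definition arclength_param Gamma (L : R) gamma :=
  [/\ 0 <= L, Gamma = gamma @` `[0, L],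
      {in `[0, L[ &, injective gamma}
    & forall s t, 0 <= s -> s <= t -> t <= L ->
        curve_length gamma s t = (t - s)%:E].

End Curves.

(* Main.v *)
Require Import Defs.
From HB Require Import structures.
From mathcomp Require Import all_boot all_order all_algebra.
From mathcomp Require Import all_classical all_reals all_analysis.
From mathcomp Require Import measurable_realfun ring lra.
Import Order.TTheory GRing.Theory Num.Theory.
Import numFieldNormedType.Exports.

Local Open Scope classical_set_scope.
Local Open Scope ring_scope.

(** Write [N f] for the nontangential maximal function of [f]. Only the size of
    [f] matters: if [f z] is larger than [t] in modulus, then so is [N f xi] for
    every [xi] whose Stolz cone contains [z], and these [xi] fill an arc around
    the radial projection of [z], of length comparable with [1 - |z|]
    (near_arc_in_shadow). Thus the set where [|f| > t] lies in the tents over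
    the set where [N f > t]. A Carleson measure gives these tents a mass at most
    a multiple, depending on [alpha], of the length of the set where [N f > t]
    (tent_estimate, superlevel_maximal). Integrating over the levels
    (le_integral_superlevel) bounds the integral of [|f| ^ p] by that of [(N f)
    ^ p], and the last one is at most [M ^ p] times the integral of [|f^*| ^ p]
    by hypothesis (integral_maximal_le). Quasiregularity makes [|f|] a Borel
    function on the disk, so that its level sets have a measure.

    For a convex curve it remains to see that arclength is a Carleson measure
    with an absolute constant, that is, that a square of half-side [r] contains
    a length of the curve at most a multiple of [r] (arclength_in_square). The
    length of an arc is the supremum of the lengths of inscribed polygons, and
    these are at most the sums of the horizontal and vertical increments of
    their sides. A vertical or horizontal line meets the boundary of a convex
    set in at most two points, apart from at most two lines in each direction
    (boundary_fst_fibers, boundary_snd_fibers), and the curve is injective.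
    Hence, apart from exceptional levels, none is crossed by more than two
    sides, and the increments in one direction add up to at most twice the width
    of the square (sum_increments_le). This avoids any monotone parametrization
    of the boundary, and any comparison of perimeters. *)

(** * The modulus and polar coordinates *)

Section Plane.
Context {R : realType}.
Implicit Types z w : plane R.

Lemma sqr_modulus z : modulus z ^+ 2 = z.1 ^+ 2 + z.2 ^+ 2.
Proof. by rewrite sqr_sqrtr // addr_ge0 ?sqr_ge0. Qed.

Lemma modulus_ge0 z : 0 <= modulus z.
Proof. exact: sqrtr_ge0. Qed.

Lemma modulusD z w : modulus (z + w) <= modulus z + modulus w.
Proof.
rewrite -(@ler_pXn2r _ 2) ?nnegrE ?addr_ge0 ?modulus_ge0//.
rewrite sqrrD !sqr_modulus /=.
have cs : z.1 * w.1 + z.2 * w.2 <= modulus z * modulus w.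
  rewrite (le_trans (ler_norm _))// -(@ler_pXn2r _ 2) ?nnegrE ?mulr_ge0 ?modulus_ge0//.
  rewrite exprMn !sqr_modulus real_normK ?num_real//.
  have := sqr_ge0 (z.1 * w.2 - z.2 * w.1); lra.
lra.
Qed.

Lemma modulusN z : modulus (- z) = modulus z.
Proof. by rewrite /modulus /= !sqrrN. Qed.

Lemma modulusB z w : modulus (z - w) = modulus (w - z).
Proof. by rewrite -modulusN opprB. Qed.

Lemma ler_norm1_modulus z : `|z.1| <= modulus z.
Proof.
by rewrite -sqrtr_sqr ler_wsqrtr// lerDl sqr_ge0.
Qed.

Lemma ler_norm2_modulus z : `|z.2| <= modulus z.
Proof.
by rewrite -sqrtr_sqr ler_wsqrtr// lerDr sqr_ge0.
Qed.

Lemma modulus_le_norms z : modulus z <= `|z.1| + `|z.2|.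
Proof.
rewrite -(@ler_pXn2r _ 2) ?nnegrE ?addr_ge0 ?modulus_ge0//.
rewrite sqr_modulus sqrrD !real_normK ?num_real//.
have := mulr_ge0 (normr_ge0 z.1) (normr_ge0 z.2); lra.
Qed.

Lemma continuous_modulus : continuous (@modulus R).
Proof.
move=> z; rewrite /modulus.
apply: (@continuous_comp _ _ _ (fun z : plane R => z.1 ^+ 2 + z.2 ^+ 2) (@Num.sqrt R));
  last exact: sqrt_continuous.
by apply: cvgD; rewrite expr2; apply: cvgM; solve [exact: cvg_fst|exact: cvg_snd].
Qed.

Lemma cos_lipschitz (a b : R) : `|cos a - cos b| <= `|a - b|.
Proof.
wlog ab : a b / b <= a.
  move=> h; case: (leP b a) => [/h//|/ltW /h]; by rewrite distrC (distrC b).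
have [|c _ ->] := @MVT_segment _ (@cos R) (fun x => - sin x) b a ab _.
  apply: continuous_subspaceT; exact: continuous_cos.
rewrite normrM ler_piMl// normrN; rewrite ler_norml; apply/andP; split.
  by rewrite sin_geN1.
by rewrite sin_le1.
Qed.

Lemma sin_lipschitz (a b : R) : `|sin a - sin b| <= `|a - b|.
Proof.
wlog ab : a b / b <= a.
  move=> h; case: (leP b a) => [/h//|/ltW /h]; by rewrite distrC (distrC b).
have [|c _ ->] := @MVT_segment _ (@sin R) cos b a ab _.
  apply: continuous_subspaceT; exact: continuous_sin.
rewrite normrM ler_piMl// ler_norml; apply/andP; split.
  by rewrite cos_geN1.
by rewrite cos_le1.
Qed.

(** The sharp constant is [1]; any constant will do below, and [2] comes from
    bounding the modulus by the sum of the two coordinates. *)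
Lemma cis_lipschitz (a b : R) : modulus (cis a - cis b) <= 2 * `|a - b|.
Proof.
rewrite (le_trans (modulus_le_norms _))//= mulr2n mulrDl !mul1r.
by rewrite lerD// ?cos_lipschitz ?sin_lipschitz.
Qed.

Lemma modulusZ (r : R) z : modulus (r *: z) = `|r| * modulus z.
Proof.
rewrite /modulus /= /GRing.scale /= !exprMn -mulrDr sqrtrM ?sqr_ge0//.
by rewrite sqrtr_sqr.
Qed.

Lemma modulus_cis (t : R) : modulus (cis t) = 1.
Proof. by rewrite /modulus /= cos2Dsin2 sqrtr1. Qed.

Lemma polar_form z : exists t : R, 0 <= t <= 2 * pi /\ z = modulus z *: cis t.
Proof.
have [z0|z0] := eqVneq (modulus z) 0.
  exists 0; rewrite lexx mulr_ge0 ?pi_ge0//; split => //.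
  have := sqr_modulus z; rewrite z0 expr0n /= => /esym/eqP.
  rewrite paddr_eq0 ?sqr_ge0// !sqrf_eq0 scale0r => /andP[/eqP a /eqP b].
  by case: z a b {z0} => /= ? ? -> ->.
have r0 : 0 < modulus z by rewrite lt_neqAle eq_sym z0 modulus_ge0.
set x := z.1 / modulus z; set y := z.2 / modulus z.
have xy1 : x ^+ 2 + y ^+ 2 = 1.
  by rewrite !expr_div_n -mulrDl -sqr_modulus divff// expf_neq0.
have -> : z = modulus z *: ((x, y) : plane R).
  rewrite {1}(surjective_pairing z) /x /y; congr pair => /=;
  by rewrite /GRing.scale /= mulrCA divff ?mulr1.
rewrite modulusZ (_ : modulus (x, y) = 1) ?mulr1 ?ger0_norm ?modulus_ge0//;
  last by rewrite /modulus /= xy1 sqrtr1.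
have x1 : -1 <= x <= 1.
  rewrite -ler_norml -(@ler_pXn2r _ 2) ?nnegrE// real_normK ?num_real// expr1n.
  by rewrite -xy1 lerDl sqr_ge0.
have [a0 api] : 0 <= acos x /\ acos x <= pi by split; [exact: acos_ge0|exact: acos_lepi].
have yE : 1 - x ^+ 2 = y ^+ 2 by rewrite -xy1 addrAC subrr add0r.
have [y0|y0] := leP 0 y.
  exists (acos x); split; first by apply/andP; split => //; lra.
  by rewrite /cis sin_acos// yE sqrtr_sqr (ger0_norm y0) acosK ?in_itv.
(* in the lower half-plane the angle is the reflection of [acos x] *)
exists (2 * pi - acos x); split; first by apply/andP; split; lra.
have -> : 2 * pi - acos x = - acos x + pi *+ 2 by rewrite addrC mulr_natl.
rewrite /cis cosD2pi sinD2pi cosN sinN acosK ?in_itv// sin_acos// yE sqrtr_sqr.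
by rewrite ltr0_norm// opprK.
Qed.
End Plane.

(** * Borel sets of the plane *)

Section Topology.
Context {R : realType}.
Implicit Types z w : plane R.

(** The sigma-algebra of the plane is generated by measurable rectangles.  An
    open set is the union of the rational squares that it contains. *)
Lemma open_measurable_plane (A : set (plane R)) : open A -> measurable A.
Proof.
move=> oA.
pose box (a b r : rat) : set (plane R) :=
  `](ratr a - ratr r), (ratr a + ratr r)[ `*` `](ratr b - ratr r), (ratr b + ratr r)[.
have -> : A = \bigcup_a \bigcup_b \bigcup_r
    (if `[< box a b r `<=` A >] then box a b r else set0).
  apply/seteqP; split => [z Az|z [a _] [b _] [r _]]; last first.
    by case: ifPn => // /asboolP; exact.
  have /nbhs_ballP[e /= e0 ezA] : nbhs z A by exact: open_nbhs_nbhs.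
  have [r] : exists q : rat, ratr q \in `](0 : R), e / 2[.
    by apply: rat_in_itvoo; rewrite divr_gt0.
  rewrite in_itv /= => /andP[r0 re].
  have [a] : exists q : rat, ratr q \in `](z.1 - ratr r), (z.1 + ratr r)[.
    by apply: rat_in_itvoo; lra.
  rewrite in_itv /= => /andP[a1 a2].
  have [b] : exists q : rat, ratr q \in `](z.2 - ratr r), (z.2 + ratr r)[.
    by apply: rat_in_itvoo; lra.
  rewrite in_itv /= => /andP[b1 b2].
  exists a => //; exists b => //; exists r => //; rewrite ifT.
    by split; rewrite /= in_itv /=; apply/andP; split; lra.
  apply/asboolP => -[x y] [/=]; rewrite !in_itv /= => /andP[? ?] /andP[? ?].
  by apply: ezA; split; rewrite /ball /= ltr_norml; apply/andP; split; lra.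
apply: bigcupT_measurable_rat => a; apply: bigcupT_measurable_rat => b.
apply: bigcupT_measurable_rat => r; case: ifP => // _.
by apply: measurableX; exact: measurable_itv.
Qed.

Lemma closed_measurable_plane (A : set (plane R)) : closed A -> measurable A.
Proof.
move=> cA; rewrite -[A]setCK; apply: measurableC; apply: open_measurable_plane.
exact: closed_openC.
Qed.

Lemma continuous_measurable_plane (f : plane R -> R) :
  continuous f -> measurable_fun setT f.
Proof.
move=> cf; apply: (measurability _ (RGenOpens.measurableE R)) => _ [_ [a [b ->] <-]].
rewrite setTI; apply: open_measurable_plane; apply: open_comp; last exact: interval_open.
by move=> ? _; exact: cf.
Qed.

Definition polar (rt : R * R) : plane R := rt.1 *: cis rt.2.

Lemma continuous_polar : continuous polar.
Proof.
move=> x.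
have c1 : rt.1 * cos rt.2 @[rt --> x] --> x.1 * cos x.2.
  apply: cvgM; first exact: cvg_fst.
  by apply: (cvg_comp snd cos cvg_snd); exact: continuous_cos.
have c2 : rt.1 * sin rt.2 @[rt --> x] --> x.1 * sin x.2.
  apply: cvgM; first exact: cvg_fst.
  by apply: (cvg_comp snd sin cvg_snd); exact: continuous_sin.
exact: (cvg_pair c1 c2).
Qed.

(** A description of sectors and boxes as compact images, hence as Borel sets,
    without an argument function. *)
Definition polar_rect (r0 r1 a b : R) : set (plane R) :=
  polar @` (`[r0, r1] `*` `[a, b]).

Lemma measurable_polar_rect r0 r1 a b : measurable (polar_rect r0 r1 a b).
Proof.
apply: closed_measurable_plane; apply: compact_closed.
  exact: (@norm_hausdorff R (plane R : normedModType R)).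
apply: continuous_compact; first by apply: continuous_subspaceT; exact: continuous_polar.
by apply: compact_setX; exact: segment_compact.
Qed.

Lemma open_disk : open (@disk R).
Proof.
rewrite (_ : disk = @modulus R @^-1` [set x | x < 1])//.
apply: open_comp; last exact: open_lt.
by move=> ? _; exact: continuous_modulus.
Qed.

Lemma measurable_disk : measurable (@disk R).
Proof. apply: open_measurable_plane; exact: open_disk. Qed.

Lemma measurable_modulus : measurable_fun setT (@modulus R).
Proof. apply: continuous_measurable_plane; exact: continuous_modulus. Qed.

(** A box over a closed arc is a closed polar rectangle from which the points of
    the unit circle have been removed; the inner radius is nonnegative because
    [l] is at most [2 * pi]. *)
Lemma carleson_boxE (s t l : R) : 0 < l -> l <= 2 * pi ->
  carleson_box (circle_arc true false s t) l =
  polar_rect (1 - l / (2 * pi)) 1 s t `&` disk.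
Proof.
move=> l0 l2.
have p0 : 0 < 2 * pi :> R by rewrite mulr_gt0// pi_gt0.
have r0 : 0 <= 1 - l / (2 * pi) by rewrite subr_ge0 ler_pdivrMr ?mul1r.
apply/seteqP; split => [z [r /=]|z [] [[r u]] /= [] /=].
  rewrite in_itv /= => /andP[r1 r2] [_ [u us <-] <-]; split.
    exists (r, u) => //=; split => //=; rewrite in_itv /= r1 ltW//.
  by rewrite /disk /= modulusZ modulus_cis mulr1 ger0_norm// (le_trans r0).
rewrite !in_itv /= => /andP[r1 r2] us <-.
rewrite /disk /= modulusZ modulus_cis mulr1 ger0_norm ?(le_trans r0)// => r3.
exists r; first by rewrite /= in_itv /= r1.
by exists (cis u) => //; exists u => //=; rewrite in_itv.
Qed.

Lemma measurable_carleson_box (s t l : R) : 0 < l -> l <= 2 * pi ->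
  measurable (carleson_box (circle_arc true false s t) l).
Proof.
move=> l0 l2; rewrite carleson_boxE//; apply: measurableI.
  exact: measurable_polar_rect.
exact: measurable_disk.
Qed.

End Topology.

(** * Tents over shadows of sets *)

Section Tents.
Context {R : realType}.

(** For [A] the part of the disk where [|f| > t], this is the set where the maximal
    function of [f] exceeds [t]. *)
Definition shadow (alpha : R) (A : set (plane R)) : set (plane R) :=
  [set xi | exists2 z, A z & stolz alpha xi z].

(** For a fixed point [z] of the disk, having [z] in one's Stolz cone is an open
    condition. *)
Lemma open_shadow alpha A : open (shadow alpha A).
Proof.
rewrite (_ : shadow alpha A = \bigcup_(z in A) [set xi | stolz alpha xi z]); last first.
  by apply/seteqP; split => xi [z Az h]; exists z.
apply: bigcup_open => z Az; have [dz|dz] := pselect (disk z); last first.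
  by rewrite (_ : mkset _ = set0) ?open0// -subset0 => xi [].
rewrite (_ : mkset _ = (fun xi => modulus (z - xi)) @^-1` [set x | x < alpha * (1 - modulus z)]).
  apply: open_comp; last exact: open_lt.
  move=> xi _; apply: continuous_comp; last exact: continuous_modulus.
  by apply: (@cvgB _ (plane R : normedModType R)); [exact: cvg_cst|exact: cvg_id].
by apply/seteqP; split => xi /=; [case|split].
Qed.

Lemma measurable_shadow alpha A : measurable (shadow alpha A).
Proof. apply: open_measurable_plane; exact: open_shadow. Qed.

(** A point at distance [1 - r] from the circle is seen from every point of an
    arc of length comparable with [(alpha - 1) * (1 - r)] around its radial
    projection: going from [cis t] to [cis u] costs at most [2 * |t - u|], and the
    cone has [(alpha - 1) * (1 - r)] to spare. *)
Lemma near_arc_in_shadow alpha (A : set (plane R)) (r t u : R) :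
  1 < alpha -> 0 <= r < 1 -> A (r *: cis t) ->
  2 * `|t - u| < (alpha - 1) * (1 - r) -> shadow alpha A (cis u).
Proof.
move=> a1 /andP[r0 r1] Az tu; exists (r *: cis t) => //; split.
  by rewrite /disk /= modulusZ modulus_cis mulr1 ger0_norm.
rewrite modulusZ modulus_cis mulr1 ger0_norm//.
rewrite (_ : r *: cis t - cis u = (r - 1) *: cis t + (cis t - cis u)); last first.
  by rewrite scalerBl scale1r addrA subrK.
rewrite (le_lt_trans (modulusD _ _))// modulusZ modulus_cis mulr1 distrC.
rewrite ger0_norm ?subr_ge0 ?ltW//.
have := cis_lipschitz t u; lra.
Qed.

Section estimate.
Variables (alpha N : R) (mu : {measure set (plane R) -> \bar R}).
Variable A : set (plane R).
Hypotheses (alpha1 : 1 < alpha) (N0 : 0 <= N).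
Hypothesis muN : forall s t : R, s < t -> t <= s + 2 * pi ->
  (mu (carleson_box (circle_arc true false s t) (t - s)) <= (N * (t - s))%:E)%E.
Hypotheses (mA : measurable A) (Adisk : A `<=` disk).

(* A height of [c * l] over an arc of length [l] is at least the height of the
   Carleson box over that arc, by the first term of the maximum.  By the second
   term, a point of height more than half of it sees the whole arc. *)
Let c : R := Num.max (2 * pi)^-1 (4 / (alpha - 1)).
Let U : set R := cis @^-1` shadow alpha A.
Let pi2_gt0 : 0 < 2 * pi :> R.
Proof. by rewrite mulr_gt0 ?pi_gt0. Qed.
Let c_gt0 : 0 < c. Proof. by rewrite lt_max invr_gt0 pi2_gt0. Qed.
Let cpi : 1 <= 2 * pi * c.
Proof. by rewrite mulrC -ler_pdivrMr// div1r le_max lexx. Qed.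
Let calpha : 4 <= c * (alpha - 1).
Proof. by rewrite -ler_pdivrMr ?subr_gt0// le_max lexx orbT. Qed.

Let mU : measurable U.
Proof.
rewrite -[U]setTI; apply: measurable_cis => //; exact: measurable_shadow.
Qed.

(* The height is also bounded below, so that halving the arc [n] times leaves
   nothing. *)
Let slab n a l : set (plane R) :=
  A `&` polar_rect 0 1 a (a + l) `&`
  [set z | c * l / 2 ^+ n < 1 - modulus z <= c * l].

Let measurable_slab n a l : measurable (slab n a l).
Proof.
apply: measurableI; first by apply: measurableI => //; exact: measurable_polar_rect.
rewrite (_ : mkset _ = @modulus R @^-1` `[1 - c * l, 1 - c * l / 2 ^+ n[).
  by rewrite -[X in measurable X]setTI; exact: measurable_modulus.
apply/seteqP; split => z /=; rewrite in_itv /= => /andP[? ?]; apply/andP; split; lra.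
Qed.

(** A stopping-time argument, which replaces a covering lemma.  If the whole arc
    lies in the shadow, then the slab lies in one Carleson box whose size is
    comparable with the part of the shadow in that arc.  Otherwise no point of the
    slab has height more than [c * l / 2], because such a point would see the
    whole arc; so the slab is covered by the slabs over the two halves of the arc,
    which are one generation shallower, and the bounds for the halves add up. *)
Let slab_le n (a l : R) : 0 < l -> l <= 2 * pi ->
  (mu (slab n a l) <= (N * (2 * pi * c))%:E * lebesgue_measure (U `&` `[a, (a + l)%R[))%E.
Proof.
elim: n a l => [|n ih] a l l0 lpi.
  have -> : slab 0 a l = set0.
    rewrite -subset0 => z [_ /=]; rewrite expr0 divr1 => /andP[/lt_le_trans h /h].
    by rewrite ltxx.
  by rewrite measure0 mule_ge0// lee_fin !mulr_ge0 ?pi_ge0 ?(ltW c_gt0).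
have [JU|] := pselect (`[a, (a + l)[ `<=` U).
  rewrite setIC (setIidl JU) lebesgue_measure_itv /= lte_fin ltrDl l0.
  rewrite -EFinB addrAC subrr add0r -EFinM.
  (* Over an arc of length [l'] the Carleson box has height [l' / (2 * pi)], which
     is [c * l], or [1] when the arc is the whole circle. *)
  pose l' := Num.min (2 * pi * c * l) (2 * pi).
  have l'0 : 0 < l' by rewrite lt_min pi2_gt0 andbT; apply: mulr_gt0 => //; exact: mulr_gt0.
  have ll' : l <= l' by rewrite le_min lpi andbT; apply: ler_peMl => //; exact: ltW.
  have l'pi : l' <= 2 * pi by rewrite ge_min lexx orbT.
  have := muN a (a + l'); rewrite ltrDl lerD2l addrAC subrr add0r => /(_ l'0 l'pi) mul'.
  apply: (@le_trans _ _ (mu (carleson_box (circle_arc true false a (a + l')) l'))).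
    apply: le_measure; rewrite ?inE//; first exact: measurable_carleson_box.
    rewrite carleson_boxE// => z [[Az [[r t] /= [rI tI] zE]] /andP[_ zl]].
    split; last exact: Adisk.
    exists (r, t) => //; split => /=; move: rI tI; rewrite !in_itv /=.
      move=> /andP[r0 r1] _; rewrite r1 andbT.
      move: zl; rewrite -zE /polar /= modulusZ modulus_cis mulr1 ger0_norm// => zl.
      rewrite lerBlDr -lerBlDl ler_pdivlMr// le_min -[X in _ && (_ <= X)]mul1r; apply/andP; split.
        by rewrite -mulrA mulrC ler_wpM2l// ltW.
      by rewrite ler_pM2r// lerBlDr lerDl.
    by move=> _ /andP[at_ tb]; rewrite at_ (le_trans tb)// lerD2l.
  rewrite (le_trans mul')// lee_fin -!mulrA ler_wpM2l// !mulrA.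
  by rewrite ge_min lexx.
move=> /existsNP[u /not_implyP[/= uI nUu]].
have l2 : 0 < l / 2 by rewrite divr_gt0.
have l2pi : l / 2 <= 2 * pi by lra.
have sub : slab n.+1 a l `<=` slab n a (l / 2) `|` slab n (a + l / 2) (l / 2).
  move=> z [[Az [[r t] /= [rI tI] zE]] zl].
  have rE : modulus z = r.
    rewrite -zE /polar /= modulusZ modulus_cis mulr1 ger0_norm//.
    by move: rI; rewrite in_itv /= => /andP[].
  have {}zl : c * (l / 2) / 2 ^+ n < 1 - modulus z <= c * (l / 2).
    move/andP: zl => [z1 z2]; apply/andP; split.
      by move: z1; rewrite exprS invfM !mulrA.
    rewrite leNgt; apply/negP => z3; apply: nUu.
    have rlt1 : r < 1 by rewrite -rE; exact: Adisk.
    have r0 : 0 <= r by rewrite -rE modulus_ge0.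
    apply: (@near_arc_in_shadow alpha A r t) => //; rewrite ?r0//.
      by rewrite (_ : r *: cis t = z).
    have tu : `|t - u| <= l.
      move: tI uI; rewrite !in_itv /= => /andP[? ?] /andP[? ?].
      by rewrite ler_norml; apply/andP; split; lra.
    rewrite (@le_lt_trans _ _ (2 * l))//; first by rewrite ler_wpM2l.
    rewrite (@le_lt_trans _ _ ((alpha - 1) * (c * (l / 2))))//; last first.
      by rewrite ltr_pM2l ?subr_gt0// -rE.
    have := ler_wpM2r (ltW l2) calpha; lra.
  move: tI; rewrite in_itv /= => /andP[t1 t2].
  case: (leP t (a + l / 2)) => [t3|/ltW t3]; [left|right].
    by split => //; split => //; exists (r, t) => //; split => //=; rewrite in_itv /= t1.
  split => //; split => //; exists (r, t) => //; split => //=.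
  by rewrite in_itv /= t3 -addrA -splitr.
have half : U `&` `[a, (a + l)[ =
    U `&` `[a, (a + l / 2)[ `|` U `&` `[(a + l / 2), (a + l / 2 + l / 2)[.
  rewrite -setIUr; congr setI; apply/seteqP; split => x /=; rewrite -addrA -splitr !in_itv /=.
    by case: (leP (a + l / 2) x) => h /andP[h1 h2]; [right|left; apply/andP].
  by move=> [|] /andP[h1 h2]; apply/andP; split; lra.
rewrite half measureU//=; last first.
- rewrite -subset0 => x [[_ /=]] + [_ /=]; rewrite !in_itv /= => /andP[_ h1] /andP[h2 _].
  by move: (lt_le_trans h1 h2); rewrite ltxx.
- exact: measurableI.
- exact: measurableI.
rewrite ge0_muleDr//.
apply: (le_trans (le_measure mu _ _ sub)); rewrite ?inE//; first exact: measurableU.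
apply: (le_trans (measureU2 _ _ _)) => //.
by apply: leeD; exact: ih.
Qed.

(** The measure of a set is controlled by the length of its shadow.  The slabs
    over the full circle increase to the set [A], since points of the disk have
    positive height. *)
Lemma tent_estimate : (mu A <=
  (N * (Num.max 1 (8 * pi / (alpha - 1))))%:E * circle_measure (shadow alpha A))%E.
Proof.
have -> : Num.max 1 (8 * pi / (alpha - 1)) = 2 * pi * c.
  rewrite /c maxr_pMr ?(ltW pi2_gt0)// divff ?gt_eqF//; congr Num.max.
  by rewrite mulrCA mulrA; congr (_ / _); ring.
have -> : circle_measure (shadow alpha A) = lebesgue_measure (U `&` `[0, (0 + 2 * pi)%R[).
  by rewrite add0r.
have sub : A `<=` \bigcup_n slab n 0 (2 * pi).
  move=> z Az; have z1 : modulus z < 1 by exact: Adisk.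
  have cp : 0 < c * (2 * pi) by exact: mulr_gt0.
  have [n zn] : exists n, c * (2 * pi) / 2 ^+ n < 1 - modulus z.
    have : (fun n => (c * (2 * pi)) * (2^-1) ^+ n) @ \oo --> (0 : R).
      rewrite -[X in _ --> X](mulr0 (c * (2 * pi))); apply: cvgMr.
      by apply: cvg_expr; rewrite ger0_norm ?invf_lt1 ?ltr1n.
    move/cvgrPdist_lt => /(_ (1 - modulus z)); rewrite subr_gt0 => /(_ z1)[n _ /(_ n (leqnn n))].
    rewrite sub0r normrN ger0_norm; last by apply: mulr_ge0; [exact: ltW|exact: exprn_ge0].
    move=> h.
    by exists n; rewrite -exprVn.
  exists n => //; split; last first.
    apply/andP; split => //; apply: (@le_trans _ _ 1); last by rewrite mulrC.
    by rewrite lerBlDr lerDl modulus_ge0.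
  split => //; have [t [tI ->]] := polar_form z.
  exists (modulus z, t) => //; split => /=; rewrite in_itv /=; first by rewrite modulus_ge0 ltW.
  by rewrite add0r.
have nd : {homo (fun n => slab n 0 (2 * pi)) : n m / (n <= m)%N >-> (n <= m)%O}.
  move=> n m nm; apply/subsetPset => z [h /andP[z1 z2]]; split => //; apply/andP; split => //.
  apply: le_lt_trans z1; apply: ler_wpM2l; first by apply: mulr_ge0; exact: ltW.
  rewrite lef_pV2 ?posrE ?exprn_gt0//.
  by rewrite ler_weXn2l ?ler1n.
apply: (@le_trans _ _ (mu (\bigcup_n slab n 0 (2 * pi)))).
  by apply: le_measure; rewrite ?inE//; apply: bigcup_measurable.
have mS n := measurable_slab n 0 (2 * pi).
have cv := @nondecreasing_cvg_mu _ _ _ mu _ mS (bigcup_measurable (fun n _ => mS n)) nd.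
rewrite -(cvg_lim _ cv)//; apply: lime_le; first by apply/cvg_ex; eexists; exact: cv.
by apply: nearW => n; exact: slab_le.
Qed.
End estimate.
End Tents.

(** * From superlevel sets to integrals *)

Section Layers.
Local Open Scope ereal_scope.
Context {R : realType}.

Let level (e : R) (y : \bar R) (i : nat) : \bar R :=
  e%:E * (((i.+1%:R * e)%R%:E < y)%E)%:R%:E.

Let EFinS (e : R) n : (n.+1%:R * e)%:E = (n%:R * e)%:E + e%:E.
Proof. by rewrite -EFinD -natr1 mulrDl mul1r. Qed.

(** A staircase of step [e] below [y]: each level reached contributes [e]. *)
Lemma sum_levels_le (e : R) (y : \bar R) n : (0 < e)%R -> 0 <= y ->
  \sum_(0 <= i < n) level e y i <= mine (n%:R * e)%:E y.
Proof.
move=> e0 y0; elim: n => [|n ih]; first by rewrite big_nil mul0r le_min lexx.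
rewrite big_nat_recr//= /level; move: ih; rewrite !le_min => /andP[ih1 ih2].
case: (ltP (n.+1%:R * e)%:E y) => [h|_].
  rewrite mule1 EFinS; have s : \sum_(0 <= i < n) level e y i + e%:E <= (n%:R * e)%:E + e%:E.
    exact: leeD.
  by rewrite s/= (le_trans s)// -EFinS ltW.
rewrite mule0 adde0 ih2 andbT (le_trans ih1)// lee_fin ler_wpM2r ?(ltW e0)//.
by rewrite ler_nat.
Qed.

(** The same staircase misses [y] by at most one step.  A staircase of [n]
    levels cannot exceed [n * e], hence the truncation of [y]. *)
Lemma le_sum_levels (e : R) (y : \bar R) n : (0 < e)%R ->
  mine (n.+1%:R * e)%:E y <= e%:E + \sum_(0 <= i < n) level e y i.
Proof.
move=> e0; elim: n => [|n ih]; first by rewrite big_nil mul1r adde0 ge_min lexx.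
rewrite big_nat_recr//= /level addeA.
case: (ltP (n.+1%:R * e)%:E y) => [h|h].
  rewrite mule1 ge_min; apply/orP; left; rewrite (EFinS _ n.+1).
  by rewrite leeD// (le_trans _ ih)// le_min lexx ltW.
rewrite mule0 adde0 (le_trans _ ih)// le_min ge_min h orbT /=.
by rewrite ge_min lexx orbT.
Qed.

(** An integral is governed by the measures of superlevel sets.  Replacing both
    functions by staircases of step [e] turns the integrals into sums over the
    levels, which are compared term by term; the error is [e] times the mass of
    [D], which is finite, and [e] is arbitrary. *)
Lemma le_integral_superlevel d d' (X : measurableType d) (Y : measurableType d')
    (m1 : {measure set X -> \bar R}) (m2 : {measure set Y -> \bar R})
    (D : set X) (g : X -> R) (h : Y -> \bar R) (k : R) :
  measurable D -> m1 D < +oo -> measurable_fun D g -> (0 <= k)%R ->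
  measurable_fun setT h -> (forall y, 0 <= h y) ->
  (forall x, D x -> (0 <= g x)%R) ->
  (forall t : R, (0 < t)%R ->
    m1 (D `&` [set x | (t < g x)%R]) <= k%:E * m2 [set y | t%:E < h y]) ->
  \int[m1]_(x in D) (g x)%:E <= k%:E * \int[m2]_y h y.
Proof.
move=> mD Doo mg k0 mh h0 g0 H.
have mgt (t : R) : measurable (D `&` [set x | (t < g x)%R]).
  rewrite (_ : [set x | _] = g @^-1` `]t, +oo[); first exact: mg.
  by apply/seteqP; split => x /=; rewrite in_itv /= andbT.
have mht (t : R) : measurable [set y | t%:E < h y].
  rewrite (_ : [set x | _] = h @^-1` `]t%:E, +oo[).
    by rewrite -[X in measurable X]setTI; apply: mh => //; exact: emeasurable_itv.
  by apply/seteqP; split => x /=; rewrite in_itv /= andbT.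
pose B e i := [set y | (i.+1%:R * e)%:E < h y].
have mB e i : measurable (B e i) by exact: mht.
suff main (e : R) : (0 < e)%R ->
    \int[m1]_(x in D) (g x)%:E <= e%:E * m1 D + k%:E * \int[m2]_y h y.
  apply/lee_addgt0Pr => e e0.
  have [m0|m0] := eqVneq (m1 D) 0.
    have := main e e0; rewrite m0 mule0 add0e => /le_trans; apply.
    by rewrite leeDl// lee_fin ltW.
  have mf : m1 D \is a fin_num by rewrite ge0_fin_numE.
  have m0' : (0 < fine (m1 D))%R by rewrite fine_gt0// lt0e m0 measure_ge0/= -ge0_fin_numE.
  (* a step that makes the total error equal to [e] *)
  have := main (e / fine (m1 D))%R (divr_gt0 e0 m0').
  by rewrite -{2}(fineK mf) -EFinM divfK ?gt_eqF// addeC.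
move=> e0.
have mS i : measurable_fun D
    (fun x => e%:E * (\1_(D `&` [set x | (i.+1%:R * e < g x)%R]) x)%:E).
  apply: measurable_funeM; apply/measurable_EFinP.
  by apply: measurable_funTS; exact: measurable_indic.
have S0 i x : 0 <= e%:E * (\1_(D `&` [set x | (i.+1%:R * e < g x)%R]) x)%:E.
  by rewrite mule_ge0// lee_fin// ltW.
have step1 : \int[m1]_(x in D) (g x)%:E <= \int[m1]_(x in D)
    (e%:E + \sum_(0 <= i <oo) (e%:E * (\1_(D `&` [set x | (i.+1%:R * e < g x)%R]) x)%:E)).
  apply: ge0_le_integral => //=.
  - exact/measurable_EFinP.
  - by apply: emeasurable_funD => //; apply: ge0_emeasurable_sum.
  move=> x Dx; pose n := Num.truncn (g x / e).
  have gn : (g x <= n.+1%:R * e)%R.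
    by rewrite -ler_pdivrMr// ltW// truncnS_gt.
  have := @le_sum_levels e (g x)%:E n e0; rewrite min_r; last by rewrite lee_fin.
  move=> /le_trans; apply.
  rewrite leeD2l//; apply: le_trans (nneseries_lim_ge n _); last by move=> *; exact: S0.
  apply: lee_sum => i _; rewrite /level lee_wpmul2l ?lee_fin ?(ltW e0)//.
  by rewrite indicE; case: ltP => //= h'; rewrite mem_set.
apply: (le_trans step1); rewrite ge0_integralD//=; last 3 first.
- by move=> x _; rewrite lee_fin ltW.
- by move=> x _; exact: nneseries_ge0.
- by apply: ge0_emeasurable_sum => //.
rewrite integral_cst// leeD2l// integral_nneseries//.
have intg i : \int[m1]_(x in D) (e%:E * (\1_(D `&` [set x | (i.+1%:R * e < g x)%R]) x)%:E)
    <= k%:E * (e%:E * m2 (B e i)).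
  rewrite ge0_integralZl_EFin//; last 2 first.
  - by apply/measurable_EFinP; apply: measurable_funTS; exact: measurable_indic.
  - exact: ltW.
  rewrite integral_indic// setIAC setIid muleCA lee_wpmul2l ?lee_fin ?(ltW e0)//.
  by apply: H; rewrite mulr_gt0.
apply: (@le_trans _ _ (\sum_(0 <= i <oo) (k%:E * (e%:E * m2 (B e i))))).
  by apply: lee_nneseries => i _ //; rewrite integral_ge0.
rewrite nneseriesZl; last by move=> i _; rewrite mule_ge0// lee_fin ltW.
rewrite lee_wpmul2l//.
rewrite (eq_eseriesr (g := fun i => \int[m2]_y (e%:E * (\1_(B e i) y)%:E))); last first.
  move=> i _; rewrite ge0_integralZl_EFin ?(ltW e0)//; last first.
    by apply/measurable_EFinP; exact: measurable_indic.
  by rewrite integral_indic// setIT.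
have mT i : measurable_fun setT (fun y => e%:E * (\1_(B e i) y)%:E).
  by apply: measurable_funeM; apply/measurable_EFinP; exact: measurable_indic.
have T0 i y : 0 <= e%:E * (\1_(B e i) y)%:E.
  by rewrite mule_ge0// lee_fin// ltW.
rewrite -integral_nneseries//; apply: ge0_le_integral => //=.
- by move=> y _; exact: nneseries_ge0.
- exact: ge0_emeasurable_sum.
move=> y _; apply: lime_le; first exact: is_cvg_nneseries.
apply: nearW => n; have := @sum_levels_le e (h y) n e0 (h0 _).
rewrite le_min => /andP[_]; apply: le_trans; apply: lee_sum => i _.
rewrite /level lee_wpmul2l ?lee_fin ?(ltW e0)// indicE.
have [By|By] := pselect (B e i y); last by rewrite memNset.
by rewrite mem_set//; move: By; rewrite /B /= => ->.
Qed.

End Layers.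

(** * The nontangential maximal function *)

Section MaximalFunction.
Context {R : realType}.
Local Open Scope ereal_scope.
Implicit Types f : plane R -> plane R.

Lemma nt_max_gtE alpha f (t : R) : [set xi | t%:E < nt_max alpha f xi] =
  shadow alpha (disk `&` [set z | (t < modulus (f z))%R]).
Proof.
apply/seteqP; split => xi /=.
  move/ereal_sup_gt => [_ [z zxi <-]]; rewrite lte_fin => tz.
  by exists z => //; split => //; case: zxi.
move=> [z [_ /= tz] zxi]; apply: (@lt_le_trans _ _ (modulus (f z))%:E).
  by rewrite lte_fin.
by apply: ereal_sup_ubound; exists z.
Qed.

(** The maximal function is lower semicontinuous: its superlevel sets are
    shadows. *)
Lemma measurable_nt_max alpha f : measurable_fun setT (nt_max alpha f).
Proof.
apply: (measurability _ (ErealGenOInfty.measurableE R)).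
move=> /= _ [_ [a ->]] <-; apply: measurableI => //.
rewrite (_ : _ @^-1` _ = [set xi | a%:E < nt_max alpha f xi]).
  by rewrite nt_max_gtE; exact: measurable_shadow.
by apply/seteqP; split => x /=; rewrite in_itv /= andbT.
Qed.

Lemma carleson_norm_box (mu : {finite_measure set (plane R) -> \bar R}) :
  carleson_measure mu -> carleson_norm mu \is a fin_num /\
  0 <= carleson_norm mu /\
  forall s t : R, (s < t)%R -> (t <= s + 2 * pi)%R ->
  mu (carleson_box (circle_arc true false s t) (t - s)) <=
  (fine (carleson_norm mu) * (t - s))%:E.
Proof.
move=> [_ muy].
have ub (s t : R) : (s < t)%R -> (t <= s + 2 * pi)%R ->
    mu (carleson_box (circle_arc true false s t) (t - s)) * ((t - s)^-1)%:E <= carleson_norm mu.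
  by move=> st ts; apply: ereal_sup_ubound; exists true, false, s, t.
have n0 : 0 <= carleson_norm mu.
  apply: le_trans (ub 0%R (2 * pi)%R _ _); rewrite ?add0r ?subr0//.
    by rewrite mule_ge0// lee_fin invr_ge0 mulr_ge0// pi_ge0.
  by rewrite mulr_gt0// pi_gt0.
have nf : carleson_norm mu \is a fin_num by rewrite ge0_fin_numE.
split => //; split => // s t st ts.
rewrite EFinM fineK// -lee_pdivrMr ?subr_gt0//.
exact: ub.
Qed.

Lemma measurable_maximal_power (alpha p : R) f :
  measurable_fun setT (fun xi => `|nt_max alpha f xi| `^ p).
Proof.
apply: (measurableT_comp (measurable_poweR p)).
by apply: measurableT_comp => //; exact: measurable_nt_max.
Qed.

(** Every point of the shadow of the set where [|f| ^ p > t] has a maximal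
    function whose power exceeds [t], so the tent estimate applies.  The constant
    [N] is kept apart from the Carleson norm because arclength measure on a curve
    enters here directly, with the bound of its boxes as [N]. *)
Lemma superlevel_maximal (alpha p N t : R) f (mu : {measure set (plane R) -> \bar R}) :
  (1 < alpha)%R -> (0 < p)%R -> (0 <= N)%R ->
  (forall s t : R, (s < t)%R -> (t <= s + 2 * pi)%R ->
    mu (carleson_box (circle_arc true false s t) (t - s)) <= (N * (t - s))%:E) ->
  measurable_fun disk (fun z => modulus (f z)) ->
  mu (disk `&` [set z | (t < modulus (f z) `^ p)%R]) <=
  (N * Num.max 1 (8 * pi / (alpha - 1)))%:E *
    circle_measure [set xi | t%:E < `|nt_max alpha f xi| `^ p].
Proof.
move=> a1 p0 N0 box mf.
have mA : measurable (disk `&` [set z | (t < modulus (f z) `^ p)%R]).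
  rewrite (_ : [set x | _] = (fun z => modulus (f z) `^ p)%R @^-1` `]t, +oo[).
    have mfp : measurable_fun disk (fun z => modulus (f z) `^ p)%R.
      exact: (measurableT_comp (measurable_powR p)).
    by apply: mfp => //; exact: measurable_disk.
  by apply/seteqP; split => x /=; rewrite in_itv /= andbT.
apply: (le_trans (tent_estimate _ _ _ _ a1 _ box mA _)) => //.
have c0 : (0 <= Num.max 1 (8 * pi / (alpha - 1)))%R by rewrite le_max ler01.
rewrite lee_wpmul2l// ?lee_fin ?mulr_ge0//.
apply: le_measure; rewrite ?inE.
- exact: measurable_shadow.
- rewrite (_ : [set x | _] = (fun xi => `|nt_max alpha f xi| `^ p) @^-1` `]t%:E, +oo[).
    rewrite -[X in measurable X]setTI; apply: measurable_maximal_power => //.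
    exact: emeasurable_itv.
  by apply/seteqP; split => x /=; rewrite in_itv /= andbT.
move=> xi [z [dz /= tz] zxi] /=.
apply: (@lt_le_trans _ _ ((modulus (f z))%:E `^ p)); first by rewrite poweR_EFin lte_fin.
have le1 : (modulus (f z))%:E <= nt_max alpha f xi by apply: ereal_sup_ubound; exists z.
have le0 : 0 <= nt_max alpha f xi by apply: le_trans le1; rewrite lee_fin modulus_ge0.
by rewrite gee0_abs// gt0_ler_poweR ?(ltW p0)// in_itv /= ?leey ?andbT// lee_fin modulus_ge0.
Qed.

(** Carleson's embedding theorem for the maximal function: the superlevel estimate
    integrated over all levels. *)
Lemma carleson_maximal (alpha p : R) f (mu : {finite_measure set (plane R) -> \bar R}) :
  (1 < alpha)%R -> (0 < p)%R ->
  measurable_fun disk (fun z => modulus (f z)) -> carleson_measure mu ->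
  \int[mu]_(z in disk) ((modulus (f z)) `^ p)%:E <=
  (Num.max 1 (8 * pi / (alpha - 1)))%:E * carleson_norm mu *
    \int[circle_measure]_xi (`|nt_max alpha f xi| `^ p).
Proof.
move=> a1 p0 mf /carleson_norm_box [nf [n0 box]].
rewrite -[in leRHS](fineK nf) -EFinM [(_ * fine _)%R]mulrC.
apply: le_integral_superlevel.
- exact: measurable_disk.
- by rewrite -ge0_fin_numE// fin_num_measure//; exact: measurable_disk.
- exact: (measurableT_comp (measurable_powR p)).
- by rewrite mulr_ge0// ?fine_ge0// le_max ler01.
- exact: measurable_maximal_power.
- by move=> y; exact: poweR_ge0.
- by move=> z _; exact: powR_ge0.
by move=> t t0; apply: superlevel_maximal => //; exact: fine_ge0.
Qed.

End MaximalFunction.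

(** * Boundaries of planar convex sets *)

Section ConvexPlane.
Context {R : realType}.
Implicit Types (C : set (plane R)) (u v w z : plane R).

(** Twice the signed area of the triangle [u v w]. *)
Definition orient u v w : R :=
  (v.1 - u.1) * (w.2 - u.2) - (v.2 - u.2) * (w.1 - u.1).

Lemma convex_comb C u v (a b : R) : convex_set C -> C u -> C v ->
  0 <= a -> 0 <= b -> a + b = 1 -> C (a *: u + b *: v).
Proof.
move=> cC Cu Cv a0 b0 ab1.
have a1 : a <= 1 by lra.
have := cC u v (Itv01 a0 a1); rewrite !inE => /(_ Cu Cv).
rewrite (_ : b = 1 - a)//; lra.
Qed.

(** The three signed areas are, up to their sum, the barycentric coordinates of
    [z].  Two of them are positive, which keeps the denominators away from [0]. *)
Lemma triangle_in_convex C u v w z : convex_set C -> C u -> C v -> C w ->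
  0 < orient v w z -> 0 < orient u v z -> 0 <= orient w u z -> C z.
Proof.
move=> cC Cu Cv Cw.
set a := orient v w z; set c := orient u v z; set b := orient w u z => a0 c0 b0.
have ac : 0 < a + c by exact: addr_gt0.
have D : 0 < a + c + b by exact: ltr_wpDr.
have Cm : C ((a / (a + c)) *: u + (c / (a + c)) *: w).
  apply: convex_comb => //; rewrite ?divr_ge0 ?ltW//.
  by rewrite -mulrDl divff// gt_eqF.
have : C (((a + c) / (a + c + b)) *: ((a / (a + c)) *: u + (c / (a + c)) *: w)
   + (b / (a + c + b)) *: v).
  apply: convex_comb => //; rewrite ?divr_ge0 ?(ltW D) ?(ltW ac)//.
  by rewrite -mulrDl divff// gt_eqF.
congr (C _); move: (lt0r_neq0 ac) (lt0r_neq0 D).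
rewrite [z]surjective_pairing => ac0 D0; rewrite [in RHS]/=; congr pair => /=.
all: rewrite /GRing.scale /=.
- transitivity ((a * u.1 + b * v.1 + c * w.1) / (a + c + b)).
    by field; apply/andP.
  apply: (canLR (mulfK D0)); rewrite /a /b /c /orient; ring.
- transitivity ((a * u.2 + b * v.2 + c * w.2) / (a + c + b)).
    by field; apply/andP.
  apply: (canLR (mulfK D0)); rewrite /a /b /c /orient; ring.
Qed.

(** The diagonal from [a] to [d] cuts the quadrilateral into two triangles, and
    [z] lies in one of them.  The four strict inequalities are open conditions on
    all points involved. *)
Lemma quad_in_convex C a l d r z : convex_set C -> C a -> C l -> C d -> C r ->
  0 < orient a r z -> 0 < orient r d z -> 0 < orient d l z -> 0 < orient l a z ->
  C z.
Proof.
move=> cC Ca Cl Cd Cr ar rd dl la.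
have [h|h] := leP 0 (orient d a z).
  exact: (@triangle_in_convex C a r d).
apply: (@triangle_in_convex C d l a) => //.
by move: h; rewrite /orient => h; lra.
Qed.

Lemma continuous_orient_l v w : continuous (fun u => orient u v w).
Proof.
move=> u; rewrite /orient; apply: cvgB; apply: cvgM; apply: cvgB;
  solve [exact: cvg_cst|exact: cvg_fst|exact: cvg_snd].
Qed.

Lemma orientC u v w : orient u v w = orient v w u.
Proof. by rewrite /orient; ring. Qed.

Lemma open_orient_gt0 v w : open [set u | 0 < orient u v w].
Proof.
rewrite (_ : mkset _ = (fun u => orient u v w) @^-1` [set x | 0 < x])//.
apply: open_comp; last exact: open_gt.
by move=> ? _; exact: continuous_orient_l.
Qed.

(** The strict inequalities survive when the vertices [a] and [d] of the closure
    are moved into [C], and when [z] is moved a little. *)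
Lemma interior_of_quad C a l d r z : convex_set C ->
  closure C a -> C l -> closure C d -> C r ->
  0 < orient a r z -> 0 < orient r d z -> 0 < orient d l z -> 0 < orient l a z ->
  C° z.
Proof.
move=> cC Ca Cl Cd Cr ar rd dl la.
have [a' [Ca' [ar' la']]] : C `&`
    ([set u | 0 < orient u r z] `&` [set u | 0 < orient u z l]) !=set0.
  apply: Ca; apply: open_nbhs_nbhs; split; first by apply: openI; exact: open_orient_gt0.
  by split => //=; rewrite -orientC.
have [d' [Cd' [dl' rd']]] : C `&`
    ([set u | 0 < orient u l z] `&` [set u | 0 < orient u z r]) !=set0.
  apply: Cd; apply: open_nbhs_nbhs; split; first by apply: openI; exact: open_orient_gt0.
  by split => //=; rewrite -orientC.
have N (v w : plane R) : open [set u | 0 < orient v w u].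
  by under eq_set => u do rewrite -orientC; exact: open_orient_gt0.
have : nbhs z ([set u | 0 < orient a' r u] `&` [set u | 0 < orient r d' u] `&`
    ([set u | 0 < orient d' l u] `&` [set u | 0 < orient l a' u])).
  apply: open_nbhs_nbhs; split; first by do !apply: openI; exact: N.
  by split; split => //=; rewrite orientC.
rewrite /interior /=; apply: filterS => q [[q1 q2] [q3 q4]].
exact: (@quad_in_convex C a' l d' r).
Qed.

Lemma closure_fst_ge C (c : R) z : (forall w, C w -> c <= w.1) -> closure C z -> c <= z.1.
Proof.
move=> Cc Cz; rewrite leNgt; apply/negP => zc.
have [w [Cw /= wc]] : C `&` [set w : plane R | w.1 < c] !=set0.
  apply: Cz; apply: open_nbhs_nbhs; split => //.
  rewrite (_ : mkset _ = fst @^-1` [set x | x < c])//.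
  by apply: open_comp; [move=> ? _; exact: cvg_fst|exact: open_lt].
by have := Cc _ Cw; rewrite leNgt wc.
Qed.

Lemma closure_fst_le C (c : R) z : (forall w, C w -> w.1 <= c) -> closure C z -> z.1 <= c.
Proof.
move=> Cc Cz; rewrite leNgt; apply/negP => zc.
have [w [Cw /= wc]] : C `&` [set w : plane R | c < w.1] !=set0.
  apply: Cz; apply: open_nbhs_nbhs; split => //.
  rewrite (_ : mkset _ = fst @^-1` [set x | c < x])//.
  by apply: open_comp; [move=> ? _; exact: cvg_fst|exact: open_gt].
by have := Cc _ Cw; rewrite leNgt wc.
Qed.

Lemma subsingleton_subset1 (T : pointedType) (A : set T) :
  (forall x y, A x -> A y -> x = y) -> exists c, A `<=` [set c].
Proof.
have [[c Ac] h|A0 _] := pselect (exists c, A c).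
  by exists c => x Ax; exact: h.
by exists point => x Ax; exfalso; apply: A0; exists x.
Qed.

(** Stated with three points to avoid cardinals.  The exceptional levels allow for
    two supporting lines, which may contain a segment of the boundary. *)
Definition two_point_fibers (x : plane R -> R) (B : set (plane R)) :=
  exists c1 c2, forall u v w, B u -> B v -> B w ->
  u != v -> v != w -> w != u -> x u = x v -> x v = x w -> x u = c1 \/ x u = c2.

(** A vertical line with points of [C] strictly on both sides contains at most
    two boundary points: of three, the middle one would be interior to
    the quadrilateral spanned by the outer two and a point of [C] on each side.
    The remaining lines that meet the closure are supporting lines of [C], and there
    are at most two of these, one on the left and one on the right. *)
Lemma boundary_fst_fibers C : convex_set C -> two_point_fibers fst (closure C `\` C°).
Proof.
move=> cC.
have [c1 H1] : exists c,
    [set x | (exists2 z, closure C z & z.1 = x) /\ forall w, C w -> x <= w.1] `<=` [set c].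
  apply: (@subsingleton_subset1 (R : pointedType)) => x y [[z Cz <-] hx] [[w Cw <-] hy].
  by apply/eqP; rewrite eq_le; apply/andP; split; exact: (@closure_fst_ge C).
have [c2 H2] : exists c,
    [set x | (exists2 z, closure C z & z.1 = x) /\ forall w, C w -> w.1 <= x] `<=` [set c].
  apply: (@subsingleton_subset1 (R : pointedType)) => x y [[z Cz <-] hx] [[w Cw <-] hy].
  by apply/eqP; rewrite eq_le; apply/andP; split; exact: (@closure_fst_le C).
exists c1; exists c2 => u v w Bu Bv Bw nuv nvw nwu uv vw.
(* this allows sorting the three points by their ordinates *)
have neq2 (p q : plane R) : p != q -> p.1 = q.1 -> p.2 != q.2.
  move=> npq E; apply: contra npq => /eqP E2.
  by rewrite [p]surjective_pairing E E2 -surjective_pairing.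
have {nuv} := neq2 _ _ nuv uv; have {nvw} := neq2 _ _ nvw vw.
have {nwu neq2} := neq2 _ _ nwu (esym (etrans uv vw)); rewrite eq_sym.
move: uv vw => uv vw nuw nvw nuv; move: nuv nvw nuw.
wlog uv2 : u v w Bu Bv Bw uv vw / u.2 < v.2.
  move=> H nuv nvw nuw; case: (ltgtP u.2 v.2) => [h|h|/eqP h]; last by rewrite h in nuv.
    exact: (H u v w).
  by rewrite uv; apply: (H v u w Bv Bu Bw (esym uv) (etrans uv vw) h) => //; rewrite eq_sym.
wlog vw2 : u v w Bu Bv Bw uv vw uv2 / v.2 < w.2.
  move=> H nuv nvw nuw; case: (ltgtP v.2 w.2) => [h|h|/eqP h]; last by rewrite h in nvw.
    exact: (H u v w).
  case: (ltgtP u.2 w.2) => [h'|h'|/eqP h']; last by rewrite h' in nuw.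
    by apply: (H u w v Bu Bw Bv (etrans uv vw) (esym vw) h' h) => //; rewrite eq_sym.
  rewrite uv vw; apply: (H w u v Bw Bu Bv (esym (etrans uv vw)) uv h' uv2) => //;
    by rewrite eq_sym.
move=> _ _ _; apply: contrapT => /not_orP[n1 n2].
have [l Cl lu] : exists2 l, C l & l.1 < u.1.
  apply: contrapT => h; apply: n1; apply: H1; split; first by exists u => //; case: Bu.
  by move=> x Cx; rewrite leNgt; apply/negP => xu; apply: h; exists x.
have [r Cr ru] : exists2 r, C r & u.1 < r.1.
  apply: contrapT => h; apply: n2; apply: H2; split; first by exists u => //; case: Bu.
  by move=> x Cx; rewrite leNgt; apply/negP => xu; apply: h; exists x.
case: Bv => _; apply; apply: (@interior_of_quad C u l w r) => //.
- by case: Bu.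
- by case: Bw.
all: rewrite /orient -?vw -?uv; nra.
Qed.
End ConvexPlane.

Section Swap.
Context {R : realType}.
Implicit Types (C : set (plane R)) (z : plane R).

Definition swap z : plane R := (z.2, z.1).

Lemma continuous_swap : continuous swap.
Proof. by move=> z; exact: (cvg_pair cvg_snd cvg_fst). Qed.

Lemma swapK : involutive swap. Proof. by case. Qed.

Lemma convex_swap C : convex_set C -> convex_set (swap @^-1` C).
Proof.
move=> cC x y k; rewrite !inE /= => Cx Cy.
by have := cC _ _ k (mem_set Cx) (mem_set Cy); rewrite inE.
Qed.

(** Reflection in the diagonal exchanges the two coordinates, and reduces
    horizontal lines to vertical ones. *)
Lemma boundary_swap C z : (closure C `\` C°) z ->
  (closure (swap @^-1` C) `\` (swap @^-1` C)°) (swap z).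
Proof.
move=> [Cz nCz]; split=> [N Nz|H0].
  by have [[a b] [Cw Nw]] := Cz _ (continuous_swap z N Nz); exists (b, a).
have H : nbhs z (swap @^-1` (swap @^-1` C)) by exact: continuous_swap.
rewrite (_ : swap @^-1` _ = C) in H; first exact: nCz.
by apply/seteqP; split => -[a b].
Qed.

Lemma boundary_snd_fibers C : convex_set C -> two_point_fibers snd (closure C `\` C°).
Proof.
move=> /convex_swap/boundary_fst_fibers [c1 [c2 H]]; exists c1, c2 => u v w Bu Bv Bw.
move=> uv vw wu; apply: (H (swap u) (swap v) (swap w));
  first [exact: boundary_swap|by rewrite (can_eq swapK)].
Qed.
End Swap.

(** * Counting crossings *)

Section Indicatrix.
Context {R : realType}.

(** Banach's indicatrix in one direction only.  By the intermediate value
    theorem, each level strictly between the values of [x] at the ends of a piece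
    is attained inside that piece.  The sum of the increments is thus at most the
    integral over the levels of the number of pieces that attain them.  This
    number is at most [2] off [c1] and [c2], and is [0] outside the range
    of [x]. *)
Lemma sum_increments_le (T : finType) (P : pred T) (x : R -> R) (u v : T -> R)
    (x0 w c1 c2 : R) :
  (forall k, P k -> u k <= v k) ->
  (forall k, P k -> {within `[u k, v k], continuous x}) ->
  (forall k t, P k -> u k <= t <= v k -> x0 <= x t <= x0 + w) ->
  (forall i j k r s t, i != j -> j != k -> k != i -> P i -> P j -> P k ->
    u i < r < v i -> u j < s < v j -> u k < t < v k ->
    x r = x s -> x s = x t -> x r = c1 \/ x r = c2) ->
  0 <= w -> \sum_(k | P k) `|x (v k) - x (u k)| <= 2 * w.
Proof.
move=> uv cx xb mult w0.
pose lo k := Num.min (x (u k)) (x (v k)); pose hi k := Num.max (x (u k)) (x (v k)).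
(* the two exceptional levels are removed, so that no level lies in three of
   these sets *)
pose K k : set R := `]lo k, hi k[ `\` ([set c1] `|` [set c2]).
have mpt : measurable ([set c1] `|` [set c2]) by apply: measurableU; exact: measurable_set1.
have mK k : measurable (K k) by apply: measurableD => //; exact: measurable_itv.
have K_hit k c : P k -> K k c -> exists2 t, u k < t < v k & x t = c.
  move=> Pk [/=]; rewrite in_itv /= => /andP[lc ch] _.
  have := IVT (uv k Pk) (cx k Pk) (v := c); rewrite -/(lo k) -/(hi k) !ltW// => /(_ isT)[t tI xt].
  exists t => //; move: tI; rewrite in_itv /= => /andP[ut tv].
  rewrite !lt_neqAle ut tv !andbT; apply/andP; split; apply/eqP => E.
    move: lc ch; rewrite -xt -E /lo /hi gt_min lt_max !ltxx /=.
    by move=> h1 /(lt_trans h1); rewrite ltxx.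
  move: lc ch; rewrite -xt E /lo /hi gt_min lt_max !ltxx /= !orbF.
  by move=> h1 /(lt_trans h1); rewrite ltxx.
have lamK k : (`|x (v k) - x (u k)|%:E <= lebesgue_measure (K k))%E.
  have -> : (`|x (v k) - x (u k)|%:E = @lebesgue_measure R `]lo k, hi k[%classic)%E.
    rewrite lebesgue_measure_itv /= lte_fin /lo /hi.
    case: (ltgtP (x (u k)) (x (v k))) => [h|h|->].
    - by rewrite h gtr0_norm ?subr_gt0.
    - by rewrite h ltr0_norm ?subr_lt0// opprB.
    - by rewrite ltxx subrr normr0.
  apply: (@le_trans _ _ (lebesgue_measure (K k `|` ([set c1] `|` [set c2])))).
    apply: le_measure; rewrite ?inE; [exact: measurable_itv| |].
      by apply: measurableU; [exact: mK|exact: mpt].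
    move=> c cI; have [cS|cS] := pselect (([set c1] `|` [set c2]) c); first by right.
    by left.
  apply: le_trans (measureU2 lebesgue_measure (mK k) mpt) _.
  rewrite [X in (_ + X)%E](_ : _ = 0%E) ?adde0//.
  have h3 := measureU2 lebesgue_measure (measurable_set1 c1) (measurable_set1 c2).
  apply/eqP; rewrite eq_le measure_ge0 andbT (le_trans h3)//.
  by rewrite -[leRHS]add0e; apply: leeD; rewrite le_eqVlt; apply/orP; left; apply/eqP;
    exact: lebesgue_measure_set1.
have count c : (\sum_(k | P k) (\1_(K k) c)%:E <= (2 * \1_`[x0, x0 + w] c)%:E :> \bar R)%E.
  rewrite sumEFin lee_fin.
  have -> : \sum_(k | P k) \1_(K k) c = #|[set k | P k & c \in K k]|%:R :> R.
    rewrite -sum1_card natr_sum [RHS]big_mkcond [LHS]big_mkcond; apply: eq_bigr => k _.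
    by rewrite inE indicE; case: (P k); case: (c \in K k).
  have [/set0Pn[k]|] := boolP ([set k | P k & c \in K k] != finset.set0); last first.
    by rewrite negbK => /eqP ->; rewrite cards0 mulr_ge0.
  rewrite inE => /andP[Pk /set_mem cK].
  have -> : \1_`[x0, x0 + w] c = 1 :> R.
    have [t /andP[ut tv] <-] := K_hit k c Pk cK.
    by rewrite indicE mem_set//= in_itv /=; apply: (xb k) => //; rewrite !ltW.
  rewrite mulr1 ler_nat leqNgt; apply/negP => /card_gt2P.
  move=> [i [j [l [[]]]]]; rewrite !inE => /andP[Pi /set_mem Ki] /andP[Pj /set_mem Kj].
  move=> /andP[Pl /set_mem Kl] [ij jl li].
  have [r rI rc] := K_hit i c Pi Ki; have [s sI sc] := K_hit j c Pj Kj.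
  have [t tI tc] := K_hit l c Pl Kl.
  have := mult i j l r s t ij jl li Pi Pj Pl rI sI tI; rewrite rc sc tc => /(_ erefl erefl) h.
  by case: cK => _; apply; case: h => h; [left|right].
rewrite -lee_fin -sumEFin.
apply: (@le_trans _ _ (\sum_(k | P k) lebesgue_measure (K k))%E); first exact: lee_sum.
have KE k : lebesgue_measure (K k) = (\int[@lebesgue_measure R]_c (\1_(K k) c)%:E)%E.
  have E : K k `&` setT = K k by exact: setIT.
  by rewrite integral_indic //; [rewrite E|exact: mK].
rewrite (eq_bigr _ (fun k _ => KE k)).
have mi k : measurable_fun setT (fun c : R => (\1_(K k) c)%:E).
  by apply/measurable_EFinP; exact: measurable_indic.
rewrite -big_filter -ge0_integral_sum//; last by move=> k; exact: mi.
apply: (@le_trans _ _ (\int[@lebesgue_measure R]_c (2 * \1_`[x0, x0 + w] c)%:E)%E).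
  apply: ge0_le_integral => //=.
  - by move=> c _; apply: sume_ge0.
  - apply: emeasurable_sum => k; exact: mi.
  - apply/measurable_EFinP; apply: measurable_funM => //; exact: measurable_indic.
  - by move=> c _; rewrite big_filter.
under eq_integral do rewrite EFinM.
rewrite ge0_integralZl_EFin //.
have E : `[x0, x0 + w]%classic `&` setT = `[x0, x0 + w]%classic by exact: setIT.
rewrite integral_indic // E EFinM lee_wpmul2l ?lee_fin//.
rewrite le_eqVlt; apply/orP; left; apply/eqP.
transitivity (@lebesgue_measure R `[x0, x0 + w]%classic); first by [].
rewrite lebesgue_measure_itv /= lte_fin ltrDl.
case: ltgtP w0 => // [w1|<-] _; last by [].
by rewrite -EFinB addrAC subrr add0r.
by apply/measurable_EFinP; exact: measurable_indic.
Qed.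
End Indicatrix.

(** * Length of a curve inside a square *)

Section Partitions.
Context {R : realType}.

Lemma itv_partition_nth_homo (a b : R) s (j k : nat) : itv_partition a b s ->
  (j <= k)%N -> (k <= size s)%N -> nth b (a :: s) j <= nth b (a :: s) k.
Proof.
move=> [ps _] jk ks.
have so : sorted <=%O (a :: s) by apply: sub_path ps => x y /ltW.
by apply: (sorted_leq_nth le_trans le_refl b so); rewrite ?inE ?ltnS//; exact: leq_trans jk ks.
Qed.

Lemma lebesgue_measure_bigcup_le n (P : pred 'I_n) (J : 'I_n -> set R) :
  (@lebesgue_measure R (\big[setU/set0]_(i < n | P i) J i) <=
   \sum_(i < n | P i) @lebesgue_measure R (J i))%E.
Proof.
elim/big_rec2: _ => [|i A y _ ih]; first by rewrite measure0.
by apply: (le_trans (outer_measureU2 _ _ _)); rewrite leeD2l.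
Qed.

(** The value of the measure on an arbitrary set is its outer measure, so that
    monotonicity asks for no measurability. *)
Lemma le_lebesgue_measure (A B : set R) : A `<=` B ->
  (@lebesgue_measure R A <= @lebesgue_measure R B)%E.
Proof. by move=> AB; apply: le_outer_measure. Qed.

End Partitions.

Section ArcLength.
Context {R : realType}.
Variables (L : R) (gamma : R -> plane R) (B : set (plane R)).
Hypothesis L0 : 0 < L.
Hypothesis gamma_lip : forall s t, modulus (gamma s - gamma t) <= `|s - t|.
Hypothesis gamma_inj : {in `[0, L[ &, injective gamma}.
Hypothesis gammaB : forall t : R, 0 <= t <= L -> B (gamma t).
Hypothesis gamma_len : forall s t : R, 0 <= s -> s < t -> t <= L ->
  curve_length gamma s t = (t - s)%:E.
Hypotheses (Bfst : two_point_fibers fst B) (Bsnd : two_point_fibers snd B).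

Lemma long_partition (s t e : R) : 0 <= s -> s < t -> t <= L -> 0 < e ->
  exists2 p, itv_partition s t p & t - s - e <= polygonal_length gamma s t p.
Proof.
move=> s0 st tL e0; apply: contrapT => H.
have : (curve_length gamma s t <= (t - s - e)%:E)%E.
  apply: ge_ereal_sup => _ [p pst <-]; rewrite lee_fin leNgt; apply/negP => lt.
  by apply: H; exists p => //; exact: ltW.
by rewrite gamma_len// lee_fin; lra.
Qed.

Section pieces.
Variables (n : nat) (n0 : (0 < n)%N) (r x0 y0 : R).
Hypothesis r0 : 0 <= r.
Let d := L / n%:R.
Let d0 : 0 < d. Proof. by rewrite divr_gt0// ltr0n. Qed.
Let a (i : nat) : R := i%:R * d.
Let aS i : a i.+1 = a i + d. Proof. by rewrite /a -natr1 mulrDl mul1r. Qed.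
Let a_ge0 i : 0 <= a i. Proof. by rewrite mulr_ge0// ltW. Qed.
Let a_le i j : (i <= j)%N -> a i <= a j.
Proof. by move=> ij; rewrite ler_wpM2r ?ler_nat// ltW. Qed.
Let a_leL (i : nat) : (i <= n)%N -> a i <= L.
Proof.
move=> i_n; apply: (le_trans (a_le _ _ i_n)).
by rewrite /a /d mulrC divfK// pnatr_eq0 -lt0n.
Qed.

(** Cut the curve into [n] arcs of length [d], and keep those that touch the
    square of half-side [r].  They stay in the square of half-side [r + d].  The
    length of each is nearly that of an inscribed polygon, whose sides are at most
    the sums of their horizontal and vertical increments.  All the sides of all
    the polygons are chords of disjoint pieces of an injective curve in [B], so
    in each direction the increments add up to at most twice the side
    [2 * (r + d)]. *)
Lemma touching_pieces_le (P : pred 'I_n) :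
  (forall i, P i -> exists t, [/\ i%:R * d <= t <= i.+1%:R * d,
    `|(gamma t).1 - x0| <= r & `|(gamma t).2 - y0| <= r]) ->
  \sum_(i < n | P i) d <= 8 * (r + d).
Proof.
move=> Phit.
apply/ler_addgt0Pr => e e0.
have en : 0 < e / n%:R by rewrite divr_gt0// ltr0n.
have /choice[s sP] : forall i : 'I_n, exists p, itv_partition (a i) (a i.+1) p /\
    d - e / n%:R <= polygonal_length gamma (a i) (a i.+1) p.
  move=> i; have [||p pP pl] := @long_partition (a i) (a i.+1) (e / n%:R) (a_ge0 i) _ _ en.
  - by rewrite aS ltrDl.
  - exact: a_leL.
  by exists p; split => //; apply: le_trans pl; rewrite aS; lra.
(* a side of a polygon: an arc of the curve and a position in its partition *)
pose T : finType := {i : 'I_n & 'I_(size (s i))}.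
pose g (i : 'I_n) k := nth (a i.+1) (a i :: s i) k.
pose u (p : T) := g (tag p) (tagged p).
pose v (p : T) := g (tag p) (tagged p).+1.
have g_ge i k : (k <= size (s i))%N -> a i <= g i k.
  by move=> ks; apply: itv_partition_nth_ge; [exact: ks|exact: (sP i).1].
have g_le i k : (k <= size (s i))%N -> g i k <= a i.+1.
  by move=> ks; apply: itv_partition_nth_le; [exact: ks|exact: (sP i).1].
have g_homo i j k : (j <= k)%N -> (k <= size (s i))%N -> g i j <= g i k.
  by move=> jk ks; apply: itv_partition_nth_homo => //; exact: (sP i).1.
have uv (p : T) : u p <= v p by exact: g_homo.
have au (p : T) : a (tag p) <= u p by apply: g_ge; exact: ltnW.
have va (p : T) : v p <= a (tag p).+1 by exact: g_le.
have disj (p q : T) t t' : p != q -> u p < t < v p -> u q < t' < v q -> t != t'.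
  move=> + /andP[t1 t2] /andP[t1' t2']; apply: contra => /eqP E; subst t'.
  have tags : tag p = tag q.
    apply: val_inj; case: (ltngtP (tag p) (tag q)) => // h; exfalso.
    - have := a_le _ _ h; have := va p; have := au q; lra.
    - have := a_le _ _ h; have := va q; have := au p; lra.
  case: p q tags t1 t2 t1' t2' => [i k] [j l] /= E; subst j; rewrite /u /v /= => t1 t2 t1' t2'.
  suff -> : k = l by [].
  apply: val_inj; case: (ltngtP k l) => // h; exfalso.
  - by have := g_homo i k.+1 l h (ltnW (ltn_ord l)); lra.
  - by have := g_homo i l.+1 k h (ltnW (ltn_ord k)); lra.
have in0L (p : T) t : u p < t < v p -> t \in `[0, L[.
  move=> /andP[t1 t2]; rewrite in_itv /=; apply/andP; split.
    have := au p; have := a_ge0 (tag p); lra.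
  have := va p; have := a_leL (tag p).+1 (ltn_ord _); lra.
have gamma_neq t t' : t \in `[0, L[ -> t' \in `[0, L[ -> t != t' -> gamma t != gamma t'.
  by move=> h h'; apply: contra => /eqP /(gamma_inj _ _ h h') ->.
have half (x : plane R -> R) (c0 : R) : two_point_fibers x B ->
    (forall z w, x (z - w) = x z - x w) -> (forall z, `|x z| <= modulus z) ->
    (forall i, P i -> exists2 t, a i <= t <= a i.+1 & `|x (gamma t) - c0| <= r) ->
    \sum_(p : T | P (tag p)) `|x (gamma (v p) - gamma (u p))| <= 4 * (r + d).
  move=> [c1 [c2 fib]] xB xm hit.
  have xlip t t' : `|x (gamma t) - x (gamma t')| <= `|t - t'|.
    by rewrite -xB (le_trans (xm _)).
  have -> : 4 * (r + d) = 2 * (2 * (r + d)) by ring.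
  under eq_bigr do rewrite xB.
  apply: (@sum_increments_le R T (fun p => P (tag p)) (x \o gamma) u v (c0 - (r + d)) _ c1 c2).
  - by move=> k _; exact: uv.
  - move=> k _; apply: continuous_subspaceT => t /=.
    apply/cvgrPdist_lt => eps eps0; near=> t'.
    apply: le_lt_trans (xlip _ _) _; near: t'.
    exact: (@cvgr_dist_lt _ R^o).
  - move=> k t Pk /andP[t1 t2] /=; have [t' /andP[t1' t2'] tr] := hit _ Pk.
    have : `|t - t'| <= d.
      have := au k; have := va k; rewrite aS in t2' * => h1 h2.
      by rewrite ler_norml; apply/andP; split; lra.
    move=> /(le_trans (xlip _ _)); move: tr; rewrite !ler_norml => /andP[? ?] /andP[? ?].
    by apply/andP; split; lra.
  - move=> i j k ti tj tk ij jk ki _ _ _ tiI tjI tkI.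
    have ti0 := in0L _ _ tiI; have tj0 := in0L _ _ tjI; have tk0 := in0L _ _ tkI.
    have inB t : t \in `[0, L[ -> B (gamma t).
      by rewrite in_itv /= => /andP[? ?]; apply: gammaB; apply/andP; split => //; exact: ltW.
    apply: fib; [exact: inB|exact: inB|exact: inB| | |].
    - by apply: gamma_neq => //; apply: (disj _ _ _ _ ij).
    - by apply: gamma_neq => //; apply: (disj _ _ _ _ jk).
    - by apply: gamma_neq => //; apply: (disj _ _ _ _ ki).
  - by rewrite mulr_ge0// addr_ge0// ltW.
have hx := half fst x0 Bfst (fun _ _ => erefl) (@ler_norm1_modulus R).
have hy := half snd y0 Bsnd (fun _ _ => erefl) (@ler_norm2_modulus R).
have total : \sum_(i < n | P i) (d - e / n%:R) <= 8 * (r + d).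
  apply: (@le_trans _ _ (\sum_(i < n | P i) \sum_(k < size (s i))
    (`|(gamma (g i k.+1) - gamma (g i k)).1| + `|(gamma (g i k.+1) - gamma (g i k)).2|))).
    apply: ler_sum => i _; apply: (le_trans (sP i).2).
    rewrite /polygonal_length big_mkord; apply: ler_sum => k _.
    exact: modulus_le_norms.
  rewrite sig_big_dep /=.
  rewrite (eq_bigl (fun p : T => P (tag p))); last by move=> p; rewrite andbT.
  rewrite big_split /=.
  have -> : 8 * (r + d) = 4 * (r + d) + 4 * (r + d) by ring.
  apply: lerD; [apply: hx|apply: hy]; by move=> i /Phit[t [? ? ?]]; exists t.
have : \sum_(i < n | P i) d <= \sum_(i < n | P i) (d - e / n%:R) + e.
  rewrite sumrB -addrA lerDl addrC subr_ge0.
  apply: (@le_trans _ _ (\sum_(i < n) (e / n%:R))).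
    by rewrite [leRHS](bigID P) /= lerDl sumr_ge0// => i _; exact: ltW.
  by rewrite sumr_const card_ord -(mulr_natr (e / n%:R)) divfK// pnatr_eq0 -lt0n.
by move=> /le_trans; apply; rewrite lerD2r.
Unshelve. all: by end_near. Qed.
End pieces.

(** With arcs of length at most [r], the arcs that touch the square have total length
    at most [8 * (r + r)]. *)
Lemma arclength_in_square (r x0 y0 : R) : 0 < r ->
  (@lebesgue_measure R (`[0%R, L]%classic `&`
     [set t | (`|(gamma t).1 - x0| <= r /\ `|(gamma t).2 - y0| <= r)%R])
   <= (16 * r)%:E)%E.
Proof.
move=> r0.
pose n := (Num.truncn (L / r)).+1.
have nL : L / n%:R <= r.
  by rewrite ler_pdivrMr ?ltr0n// mulrC -ler_pdivrMr// ltW// truncnS_gt.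
have d0 : 0 < L / n%:R by rewrite divr_gt0// ltr0n.
pose P (i : 'I_n) := `[< exists t, [/\ i%:R * (L / n%:R) <= t <= i.+1%:R * (L / n%:R),
  `|(gamma t).1 - x0| <= r & `|(gamma t).2 - y0| <= r] >].
have le8 := @touching_pieces_le n isT r x0 y0 (ltW r0) P (fun i => @asboolW _).
have := @lebesgue_measure_bigcup_le R n P
  (fun i : 'I_n => `[i%:R * (L / n%:R), i.+1%:R * (L / n%:R)]%classic).
have -> : (\sum_(i < n | P i)
    @lebesgue_measure R `[(i%:R * (L / n%:R))%R, (i.+1%:R * (L / n%:R))%R]%classic)%E =
    (\sum_(i < n | P i) (L / n%:R))%:E.
  rewrite -sumEFin; apply: eq_bigr => i _; rewrite lebesgue_measure_itv /= lte_fin.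
  rewrite -natr1 mulrDl mul1r ltrDl d0 -EFinB addrAC subrr add0r//.
move=> cover; apply: (@le_trans _ _ (\sum_(i < n | P i) (L / n%:R))%:E); last first.
  by rewrite lee_fin (le_trans le8)//; lra.
apply: le_trans cover; apply: le_lebesgue_measure => t [/= + [tx ty]].
rewrite in_itv /= => /andP[t0 tL].
have [i ti] : exists i : 'I_n, i%:R * (L / n%:R) <= t <= i.+1%:R * (L / n%:R).
  (* the end point belongs to the last arc, of index [n - 1] *)
  have [tL'|tL'] := eqVneq t L.
    exists ord_max; rewrite tL' /= [_.+1%:R * _]mulrC divfK ?pnatr_eq0// lexx andbT.
    by rewrite mulrA ler_pdivrMr ?ltr0n// mulrC ler_pM2l// ler_nat.
  have tn : 0 <= t / (L / n%:R) by rewrite divr_ge0// ltW.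
  have /andP[h1 h2] := truncn_itv tn.
  have lt : (Num.truncn (t / (L / n%:R)) < n)%N.
    rewrite truncn_lt_nat// ltr_pdivrMr// mulrC divfK ?pnatr_eq0//.
    by rewrite lt_neqAle tL' tL.
  exists (Ordinal lt) => /=; rewrite -ler_pdivlMr// h1 /=.
  by rewrite -ler_pdivrMr// ltW.
rewrite (bigD1 i) /=; first by left; rewrite /= in_itv.
by apply/asboolP; exists t.
Qed.
End ArcLength.

(** * The hypotheses on the function *)

Section ClassG.
Context {R : realType}.
Local Open Scope ereal_scope.
Implicit Types f : plane R -> plane R.

Lemma measurable_modulus_quasiregular (K : R) f : quasiregular K f ->
  measurable_fun disk (fun z => modulus (f z)).
Proof.
move=> [ux [uy [vx [vy [[[m1 _] _ _ _ _] [[m2 _] _ _ _ _] _ _]]]]].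
apply: (measurableT_comp (f := @Num.sqrt R)).
  by apply: continuous_measurable_fun; exact: sqrt_continuous.
by apply: measurable_funD; apply: measurable_funX.
Qed.

(** The [p]-th power of the norm hypothesis.  A negative [M] forces the maximal
    function to vanish almost everywhere, because a norm cannot be negative. *)
Lemma integral_maximal_le (p K alpha M : R) f : (0 < p)%R ->
  in_class_G p K alpha M f ->
  \int[circle_measure]_xi (`|nt_max alpha f xi| `^ p) <=
  (M `^ p)%:E * \int[circle_measure]_xi ((modulus (bdry alpha f xi)) `^ p)%:E.
Proof.
move=> p0 [_ _ _]; rewrite /Lp_norm_circle unlock.
set X := \int[_]_x _; set Y' := \int[_]_x _; set Y := \int[_]_x _.
have -> : Y' = Y.
  by apply: eq_integral => xi _; rewrite gee0_abs ?lee_fin ?modulus_ge0// poweR_EFin.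
have X0 : 0 <= X by apply: integral_ge0 => xi _; exact: poweR_ge0.
have Y0 : 0 <= Y by apply: integral_ge0 => xi _; rewrite lee_fin powR_ge0.
have pE (Z : \bar R) : 0 <= Z -> (Z `^ p^-1) `^ p = Z.
  by move=> Z0; rewrite -poweRrM mulVf ?gt_eqF// poweRe1.
have [M0|M0] := leP 0%R M.
  move=> h; rewrite -(pE X)// -(pE Y)// -poweR_EFin -poweRM ?poweR_ge0//.
  rewrite gt0_ler_poweR ?(ltW p0)// in_itv /= leey andbT ?poweR_ge0//.
  by rewrite mule_ge0 ?poweR_ge0.
move=> h; have : X `^ p^-1 <= 0.
  by apply: (le_trans h); rewrite mule_le0_ge0 ?poweR_ge0// lee_fin ltW.
move=> XN; have : X `^ p^-1 = 0 by apply/eqP; rewrite eq_le XN poweR_ge0.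
by move/(poweR_eq0_eq0 X0) => ->; rewrite mule_ge0// lee_fin powR_ge0.
Qed.
End ClassG.

(** * Arclength on a convex curve is a Carleson measure *)

Section CurveMeasure.
Context {R : realType}.

(** Provides arclength on the curve as a bundled measure, to which the superlevel
    estimate can be applied. *)
Lemma pushforward_arclength (L : R) (g : R -> plane R) : measurable_fun setT g ->
  exists nu : {measure set (plane R) -> \bar R},
  forall A, nu A = @lebesgue_measure R (g @^-1` A `&` `[0, L]%classic).
Proof.
move=> mg; pose m := mrestr (@lebesgue_measure R) (measurable_itv `[0, L]).
unshelve refine (ex_intro _ (pushforward m g : {measure set (plane R) -> \bar R}) _).
  exact: mg.
by [].
Qed.

End CurveMeasure.

Section Curve.
Context {R : realType}.
Implicit Types (gamma : R -> plane R) (f : plane R -> plane R).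

(** A point of the box over an arc of length [l] is at distance at most
    [l / (2 * pi)] from the arc, which itself stays within [2 * l] of its first
    point. *)
Lemma box_in_square (s t : R) : s < t -> t <= s + 2 * pi ->
  carleson_box (circle_arc true false s t) (t - s) `<=`
  [set z | `|z.1 - cos s| <= 3 * (t - s) /\ `|z.2 - sin s| <= 3 * (t - s)].
Proof.
move=> st ts z [r /= rI [_ [u /= uI <-] <-]].
move: rI uI; rewrite !in_itv /= => /andP[r1 r2] /andP[u1 u2].
set l := t - s in r1 *; have l0 : 0 < l by rewrite subr_gt0.
have p2 : 2 <= pi :> R := pi_ge2 R.
have p0 : 0 < 2 * pi :> R by lra.
have lp : l / (2 * pi) <= l by rewrite ler_pdivrMr//; nra.
have l1 : l / (2 * pi) <= 1 by rewrite ler_pdivrMr// mul1r /l; lra.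
have -> : cos s = (cis s).1 by [].
have -> : sin s = (cis s).2 by [].
suff m3 : modulus (r *: cis u - cis s) <= 3 * l.
  split; apply: le_trans m3.
    exact: (ler_norm1_modulus (r *: cis u - cis s)).
  exact: (ler_norm2_modulus (r *: cis u - cis s)).
rewrite (_ : r *: cis u - cis s = (r - 1) *: cis u + (cis u - cis s)); last first.
  by rewrite scalerBl scale1r addrA subrK.
rewrite (le_trans (modulusD _ _))// modulusZ modulus_cis mulr1 distrC.
have -> : 3 * l = l + 2 * l by ring.
apply: lerD; first by rewrite ger0_norm; lra.
apply: (le_trans (cis_lipschitz _ _)); rewrite ler_wpM2l// ger0_norm /l; lra.
Qed.

Section clamp.
Variables (L : R) (gamma : R -> plane R).
Hypothesis L0 : 0 <= L.
Hypothesis gamma_len : forall s t : R, 0 <= s -> s <= t -> t <= L ->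
  curve_length gamma s t = (t - s)%:E.

(** Nearest point of [0, L].  Composing a curve with it gives a Lipschitz, hence
    Borel, curve on the whole line without changing the curve on [0, L]. *)
Definition clamp (t : R) : R := Num.min L (Num.max 0 t).

Lemma clampE t : 0 <= t <= L -> clamp t = t.
Proof. by move=> /andP[t0 tL]; rewrite /clamp max_r// min_r. Qed.

Lemma clamp_itv t : 0 <= clamp t <= L.
Proof. by rewrite /clamp le_min L0 le_max lexx ge_min lexx. Qed.

Lemma clamp_lip s t : `|clamp s - clamp t| <= `|s - t|.
Proof.
rewrite /clamp ler_norml; have := ler_norm (s - t); have := ler_norm (- (s - t)); rewrite normrN.
by case: (leP 0 s); case: (leP 0 t); case: (leP L s); case: (leP L t); case: (leP L 0);
  move=> *; apply/andP; split; lra.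
Qed.

Lemma arclength_lip s t : 0 <= s <= L -> 0 <= t <= L ->
  modulus (gamma s - gamma t) <= `|s - t|.
Proof.
wlog st : s t / s <= t.
  move=> H; case: (leP s t) => [/H//|/ltW ts] hs ht.
  by rewrite modulusB distrC; exact: H.
move=> /andP[s0 _] /andP[_ tL].
case: (ltgtP s t) st => // [st _|-> _]; last first.
  by rewrite !subrr /modulus /= expr0n addr0 sqrtr0 normr0.
rewrite distrC ger0_norm ?subr_ge0 ?(ltW st)// -lee_fin -(gamma_len _ _ s0 (ltW st) tL).
apply: ereal_sup_ubound; exists [:: t]; first exact: itv_partition1.
by rewrite /polygonal_length big_nat1 /= modulusB.
Qed.

Lemma clamp_curve_lip s t : modulus (gamma (clamp s) - gamma (clamp t)) <= `|s - t|.
Proof. by apply: le_trans (clamp_lip s t); apply: arclength_lip; exact: clamp_itv. Qed.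

(** The length only depends on the points of partitions of subintervals
    of [0, L], which clamping fixes. *)
Lemma clamp_curve_len s t : 0 <= s -> s < t -> t <= L ->
  curve_length (gamma \o clamp) s t = (t - s)%:E.
Proof.
move=> s0 st tL; rewrite -(gamma_len _ _ s0 (ltW st) tL) /curve_length; congr ereal_sup.
apply: eq_imagel => p pst; congr EFin; rewrite /polygonal_length.
apply: eq_big_nat => k /andP[_ kp] /=.
have cl j : (j < (size p).+1)%N -> clamp (nth t (s :: p) j) = nth t (s :: p) j.
  move=> jp; apply: clampE; apply/andP; split.
    exact: le_trans s0 (itv_partition_nth_ge jp pst).
  exact: le_trans (itv_partition_nth_le jp pst) tL.
by rewrite (cl k.+1)// (cl k)// ltnW.
Qed.

Lemma measurable_clamp_curve : measurable_fun setT (gamma \o clamp).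
Proof.
have lip_mf (h : R -> R) : (forall s t, `|h s - h t| <= `|s - t|) -> measurable_fun setT h.
  move=> hl; apply: continuous_measurable_fun => t.
  apply/cvgrPdist_lt => e e0; near=> u.
  apply: le_lt_trans (hl _ _) _; near: u.
  exact: (@cvgr_dist_lt _ R^o).
rewrite (_ : gamma \o clamp = fun t => ((gamma (clamp t)).1, (gamma (clamp t)).2)); last first.
  by apply/funext => t /=; rewrite -surjective_pairing.
apply: measurable_fun_pair; apply: lip_mf => s t; apply: le_trans (clamp_curve_lip s t).
- exact: (ler_norm1_modulus (gamma (clamp s) - gamma (clamp t))).
- exact: (ler_norm2_modulus (gamma (clamp s) - gamma (clamp t))).
Unshelve. all: by end_near. Qed.
End clamp.

(** Arclength on a convex curve is a Carleson measure with constant [48]: the box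
    over an arc of length [l] lies in a square of half-side [3 * l], which contains
    a length at most [16 * (3 * l)] of the curve.  A curve of length [0] is treated
    apart. *)
Lemma convex_curve_maximal (alpha p : R) f Gamma L gamma :
  1 < alpha -> 0 < p -> measurable_fun disk (fun z => modulus (f z)) ->
  convex_curve Gamma -> Gamma `<=` disk -> arclength_param Gamma L gamma ->
  (\int[@lebesgue_measure R]_(s in `[0%R, L]) ((modulus (f (gamma s))) `^ p)%:E <=
   (48 * Num.max 1 (8 * pi / (alpha - 1)))%:E *
     \int[circle_measure]_xi (`|nt_max alpha f xi| `^ p))%E.
Proof.
move=> a1 p0 mf [_ [C [cC Cd GC]]] Gd [L0 GE ginj glen].
have c0 : 0 <= 48 * Num.max 1 (8 * pi / (alpha - 1)) :> R.
  by rewrite mulr_ge0// le_max ler01.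
have [L00|Ln0] := eqVneq L 0.
  rewrite L00 set_itv1 integral_set1 mule_ge0 ?lee_fin//.
  by apply: integral_ge0 => xi _; exact: poweR_ge0.
have {}L0 : 0 < L by rewrite lt_neqAle eq_sym Ln0.
pose g := gamma \o clamp L.
have gE t : 0 <= t <= L -> g t = gamma t by move=> tI; rewrite /g /= clampE.
have gG t : 0 <= t <= L -> Gamma (g t).
  by move=> tI; rewrite gE// GE; exists t => //=; rewrite in_itv.
have mg : measurable_fun setT g by exact: (measurable_clamp_curve _ _ (ltW L0) glen).
have [nu nuE] := pushforward_arclength L g mg.
have square (r x0 y0 : R) : 0 < r -> (@lebesgue_measure R (`[0%R, L]%classic `&`
    [set t | (`|(g t).1 - x0| <= r /\ `|(g t).2 - y0| <= r)%R]) <= (16 * r)%:E)%E.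
  apply: (@arclength_in_square R L g (closure C `\` C°)) => //.
  - exact: (clamp_curve_lip _ _ (ltW L0) glen).
  - move=> s t sI tI; rewrite !gE; last 2 first.
    + by move: tI; rewrite in_itv /= => /andP[-> /ltW].
    + by move: sI; rewrite in_itv /= => /andP[-> /ltW].
    exact: ginj.
  - by move=> t /gG /GC.
  - exact: (clamp_curve_len _ _ glen).
  - exact: boundary_fst_fibers.
  - exact: boundary_snd_fibers.
have box (s t : R) : s < t -> t <= s + 2 * pi ->
    (nu (carleson_box (circle_arc true false s t) (t - s)) <= (48 * (t - s))%:E)%E.
  move=> st ts; rewrite nuE.
  have -> : 48 * (t - s) = 16 * (3 * (t - s)) by ring.
  have l0 : 0 < 3 * (t - s) by rewrite mulr_gt0// subr_gt0.
  apply: le_trans (square _ (cos s) (sin s) l0); apply: le_lebesgue_measure.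
  by move=> u [gu uI]; split => //; exact: (box_in_square _ _ st ts).
have -> : (\int[@lebesgue_measure R]_(s in `[0%R, L]) ((modulus (f (gamma s))) `^ p)%:E =
    \int[@lebesgue_measure R]_(s in `[0%R, L]) ((modulus (f (g s))) `^ p)%:E)%E.
  by apply: eq_integral => s; rewrite inE /= in_itv /= => sI; rewrite gE.
have mfg : measurable_fun `[0%R, L]%classic (fun s => modulus (f (g s)) `^ p).
  apply: (measurableT_comp (measurable_powR p)).
  apply: (measurable_comp measurable_disk _ mf); last exact: measurable_funTS.
  by move=> z [s /=]; rewrite in_itv /= => sI <-; apply: Gd; exact: gG.
have fin_L : (@lebesgue_measure R `[0%R, L]%classic < +oo)%E.
  by rewrite lebesgue_measure_itv /= lte_fin L0 -EFinB ltry.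
apply: le_integral_superlevel => //.
- exact: measurable_maximal_power.
- by move=> y; exact: poweR_ge0.
- by move=> s _; exact: powR_ge0.
move=> t t0; apply: le_trans (superlevel_maximal _ _ _ t _ _ a1 p0 _ box mf) => //.
rewrite nuE; apply: le_lebesgue_measure => s [/= sI ts]; split => //; split => //.
by apply: Gd; apply: gG; move: sI; rewrite in_itv.
Qed.

End Curve.

Theorem theorem3p2 (R : realType) (alpha : R) (halpha : 1 < alpha) :
  exists B C : R,
  forall (p K M : R) (f : plane R -> plane R),
  0 < p -> 1 <= K -> in_class_G p K alpha M f ->
  (forall Gamma : set (plane R), convex_curve Gamma -> Gamma `<=` disk ->
     forall (L : R) (gamma : R -> plane R), arclength_param Gamma L gamma ->
     (\int[@lebesgue_measure R]_(s in `[0%R, L]) ((modulus (f (gamma s))) `^ p)%:E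
      <= (B * M `^ p)%:E *
         \int[circle_measure]_xi ((modulus (bdry alpha f xi)) `^ p)%:E)%E) /\
  (forall mu : {finite_measure set (plane R) -> \bar R}, carleson_measure mu ->
     (\int[mu]_(z in disk) ((modulus (f z)) `^ p)%:E
      <= C%:E * carleson_norm mu * (M `^ p)%:E *
         \int[circle_measure]_xi ((modulus (bdry alpha f xi)) `^ p)%:E)%E).
Proof.
pose c := Num.max 1 (8 * pi / (alpha - 1)) : R.
have c0 : 0 <= c by rewrite le_max ler01.
exists (48 * c), c => p K M f p0 _ fG.
have mf : measurable_fun disk (fun z => modulus (f z)).
  by case: fG => /measurable_modulus_quasiregular.
have maxle := integral_maximal_le p K alpha M f p0 fG.
split=> [Gamma Gc Gd L gamma Gp|mu muC].
  apply: (le_trans (convex_curve_maximal _ _ _ _ _ _ halpha p0 mf Gc Gd Gp)).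
  by rewrite [in leRHS]EFinM -muleA lee_wpmul2l// lee_fin mulr_ge0.
apply: (le_trans (carleson_maximal _ _ _ _ halpha p0 mf muC)).
have [_ [n0 _]] := carleson_norm_box mu muC.
by rewrite -[leRHS]muleA lee_wpmul2l// mule_ge0.
Qed.
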